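(* Let $F$ be a semi-invariant Riemannian map from a Riemannian manifold $(M,g_M)$ to a Kähler manifold $(N,g_N,P)$ such that $(\mathrm{range}\,F_\ast)^\perp$ is totally geodesic, and let $\alpha:I\to M$ be a geodesic curve on $M$. Then the curve $\beta=F\circ\alpha$ is a geodesic on $N$ if and only if $$-S_{\omega F_\ast X}F_\ast X+F_\ast(\nabla^M_X\,{}^\ast F_\ast BV)-S_{CV}F_\ast X+\nabla^N_V\phi F_\ast X+\nabla^N_VBV+F_\ast(\nabla^M_X\,{}^\ast F_\ast\phi F_\ast X)=0$$ and $$(\nabla F_\ast)(X,{}^\ast F_\ast\phi F_\ast X)+\nabla^{F\perp}_X\omega F_\ast X+(\nabla F_\ast)(X,{}^\ast F_\ast BV)+\nabla^{F\perp}_XCV+\nabla^{F\perp}_V\omega F_\ast X+\nabla^{F\perp}_VCV=0,$$ where $F_\ast X\in\Gamma(\mathrm{range}\,F_\ast)$ and $V\in\Gamma((\mathrm{range}\,F_\ast)^\perp)$ are the components of $\dot\beta(t)$, i.e. $\dot\beta=F_\ast X+V$.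
   Context: $\nabla^M,\nabla^N$ are the Levi-Civita connections and $\Gamma(\cdot)$ denotes sections. $F:M\to N$ is smooth with $0<\mathrm{rank}\,F<\min\{\dim M,\dim N\}$; $(\ker F_\ast)^\perp\subset TM$ and $(\mathrm{range}\,F_\ast)^\perp\subset TN$ are orthogonal complements, and $\mathrm{range}\,F_\ast$, $(\mathrm{range}\,F_\ast)^\perp$ are regarded as complementary orthogonal distributions on $N$. $F$ is a Riemannian map if $g_N(F_\ast X,F_\ast Y)=g_M(X,Y)$ for all $X,Y\in\Gamma((\ker F_\ast)^\perp)$; in $F_\ast X$ we take $X\in\Gamma((\ker F_\ast)^\perp)$. ${}^\ast F_\ast$ is the adjoint of $F_\ast$: $g_M(X,{}^\ast F_\ast W)=g_N(F_\ast X,W)$. The second fundamental form of $F$ is $(\nabla F_\ast)(X,Y)=\nabla^F_XF_\ast Y-F_\ast(\nabla^M_XY)$, with $\nabla^F$ the pullback of $\nabla^N$ (so $\nabla^F_XF_\ast Y=\nabla^N_{F_\ast X}F_\ast Y$). For $V\in\Gamma((\mathrm{range}\,F_\ast)^\perp)$, $\nabla^N_{F_\ast X}V=-S_VF_\ast X+\nabla^{F\perp}_XV$, with $-S_VF_\ast X$ the $\mathrm{range}\,F_\ast$-component and $\nabla^{F\perp}_XV$ the $(\mathrm{range}\,F_\ast)^\perp$-component; for $U,V\in\Gamma((\mathrm{range}\,F_\ast)^\perp)$, $\nabla^{F\perp}_UV$ is the $(\mathrm{range}\,F_\ast)^\perp$-component of $\nabla^N_UV$. $(\mathrm{range}\,F_\ast)^\perp$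 is totally geodesic if $\nabla^N_UV=\nabla^{F\perp}_UV$ for all such $U,V$. $(N,g_N,P)$ is Kähler: $P$ is a $(1,1)$ tensor with $P^2=-I$, $g_N(P\cdot,P\cdot)=g_N$, $\nabla^NP=0$. A Riemannian map $F$ to $N$ is semi-invariant if there are subbundles $D_1,D_2$ with $\mathrm{range}\,F_\ast=D_1\oplus D_2$ (orthogonal), $P(D_1)=D_1$ and $P(D_2)\subseteq(\mathrm{range}\,F_\ast)^\perp$. For $F_\ast X\in\Gamma(\mathrm{range}\,F_\ast)$ write $PF_\ast X=\phi F_\ast X+\omega F_\ast X$ with $\phi F_\ast X\in\Gamma(D_1)$, $\omega F_\ast X\in\Gamma(PD_2)$. For $V\in\Gamma((\mathrm{range}\,F_\ast)^\perp)$ write $PV=BV+CV$ with $BV\in\Gamma(\mathrm{range}\,F_\ast)$ and $CV\in\Gamma(\eta)$, where $\eta$ is the orthogonal complement of $PD_2$ in $(\mathrm{range}\,F_\ast)^\perp$. *)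

(* Defs.v *)
From HB Require Import structures.
From mathcomp Require Import all_boot all_order all_algebra.
From mathcomp Require Import all_classical all_reals all_analysis.

Set Implicit Arguments.
Unset Strict Implicit.
Unset Printing Implicit Defensive.

Import Order.TTheory GRing.Theory Num.Theory.
Import numFieldNormedType.Exports.

Local Open Scope classical_set_scope.
Local Open Scope ring_scope.

Section Smoothness.
Context {R : realType} {V W : normedModType R}.

Fixpoint Ck (k : nat) (U : set V) (f : V -> W) : Prop :=
  match k with
  | 0%N => forall x, U x -> {for x, continuous f}
  | k'.+1 => (forall x, U x -> differentiable f x) /\
             (forall v : V, Ck k' U (fun x => 'D_v f x))
  end.

Definition smooth_on (U : set V) (f : V -> W) : Prop := forall k, Ck k U f.

Definition smooth_at (x : V) (f : V -> W) : Prop :=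
  exists U : set V, [/\ open U, U x & smooth_on U f].

End Smoothness.

Record chart (M : topologicalType) (V : Type) := Chart {
  chart_dom : set M;
  coord : M -> V;
  param : V -> M (* inverse of [coord] on [coord @` chart_dom] *)
}.

Record is_chart (R : realType) (n : nat) (M : topologicalType)
    (c : chart M 'rV[R]_n) : Prop := IsChart {
  chart_dom_open : open (chart_dom c);
  chart_img_open : open (coord c @` chart_dom c);
  chart_coordK : forall p, chart_dom c p -> param c (coord c p) = p;
  chart_coord_cont : forall p, chart_dom c p -> {for p, continuous (coord c)};
  chart_param_cont : forall p, chart_dom c p ->
    {for coord c p, continuous (param c)}
}.

Record manifold (R : realType) (n : nat) := Manifold {
  mfd_carrier :> topologicalType;
  atlas : set (chart mfd_carrier 'rV[R]_n);
  manifold_hausdorff : hausdorff_space mfd_carrier;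
  manifold_second_countable : @second_countable mfd_carrier;
  atlas_chart : forall c, atlas c -> is_chart c;
  atlas_cover : forall p : mfd_carrier, exists2 c, atlas c & chart_dom c p;
  atlas_compat : forall c c', atlas c -> atlas c' ->
    smooth_on (coord c @` (chart_dom c `&` chart_dom c')) (coord c' \o param c)
}.

Section SmoothMaps.
Context {R : realType}.

Definition smooth_fun m (M : manifold R m) (f : M -> R) : Prop :=
  forall p : M, exists c, [/\ atlas c, chart_dom c p &
    smooth_at (coord c p) (f \o param c : 'rV[R]_m -> R^o)].

Definition smooth_map m n (M : manifold R m) (N : manifold R n)
    (F : M -> N) : Prop :=
  forall p : M, {for p, continuous F} /\
    exists c c', [/\ atlas c, chart_dom c p, atlas c', chart_dom c' (F p) &
      smooth_at (coord c p) (coord c' \o F \o param c)].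

Definition smooth_curve m (M : manifold R m) (I : set R) (gamma : R -> M) :
    Prop :=
  forall t : R, I t -> {for t, continuous gamma} /\
    exists c, [/\ atlas c, chart_dom c (gamma t) &
      smooth_at (t : R^o) (coord c \o gamma : R^o -> 'rV[R]_m)].

End SmoothMaps.

(* Tangent vectors are represented by the derivations they induce: a tangent
   vector is a functional on real functions, whose values matter only on smooth
   functions and are 0, by convention, on the others. This convention makes the
   functional unique, so that equality of tangent vectors is plain equality. *)
Notation functional M R := ((M -> R) -> R^o) (only parsing).
Notation vfield M R := (M -> functional M R) (only parsing).

Section Tangent.
Context {R : realType} {m : nat} {M : manifold R m}.
Implicit Types (p : M) (v : functional M R) (X Y : vfield M R).

(* v = \sum_i h_i d/dx^i at p, in the coordinates x of some chart at p *)
Definition tangent p v : Prop :=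
  exists c, [/\ atlas c, chart_dom c p & exists h : 'rV[R]_m, forall f : M -> R,
    v f = if `[< smooth_fun f >]
          then 'D_h (f \o param c : 'rV[R]_m -> R^o) (coord c p) else 0].

Definition smooth_vfield X : Prop :=
  (forall p, tangent p (X p)) /\
  (forall f : M -> R, smooth_fun f -> smooth_fun (fun p => X p f)).

Definition lie_bracket X Y : vfield M R := fun p f =>
  if `[< smooth_fun f >]
  then X p (fun q => Y q f) - Y p (fun q => X q f) else 0.

Definition velocity (gamma : R -> M) (t : R) : functional M R := fun f =>
  if `[< smooth_fun f >]
  then derive1 (f \o gamma : R -> R^o) t else 0.

Definition is_basis (E : set (functional M R)) (k : nat)
    (e : 'I_k -> functional M R) : Prop :=
  E = [set \sum_i a i *: e i | a in [set: 'I_k -> R]] /\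
  (forall a : 'I_k -> R, \sum_i a i *: e i = 0 -> forall i, a i = 0).

(* The local frames are restrictions of vector fields defined on all of M; by
   cutting off, this is no loss of generality. *)
Definition subbundle (E : M -> set (functional M R)) : Prop :=
  forall p, exists k (s : 'I_k -> vfield M R),
    (forall i, smooth_vfield (s i)) /\
    (\forall q \near p, is_basis (E q) (fun i => s i q)).

Definition is_section (E : M -> set (functional M R)) X : Prop :=
  smooth_vfield X /\ forall p, E p (X p).

(* the E-component of v along the decomposition E (+) E' *)
Definition component_in (E E' : set (functional M R)) v : functional M R :=
  xget 0 [set u | E u /\ E' (v - u)].

Record is_metric (g : M -> functional M R -> functional M R -> R) : Prop :=
  IsMetric {
  metric_sym : forall p u v, tangent p u -> tangent p v -> g p u v = g p v u;
  metric_linear : forall p (a : R) u v w,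
    tangent p u -> tangent p v -> tangent p w ->
    g p (a *: u + v) w = a * g p u w + g p v w;
  metric_pos : forall p v, tangent p v -> v <> 0 -> 0 < g p v v;
  metric_smooth : forall X Y, smooth_vfield X -> smooth_vfield Y ->
    smooth_fun (fun p => g p (X p) (Y p))
}.

(* [nabla p v Y] is the derivative at p of the field Y in the direction v. *)
Record is_connection (nabla : M -> functional M R -> vfield M R ->
    functional M R) : Prop := IsConnection {
  connection_tangent : forall p v Y, tangent p v -> smooth_vfield Y ->
    tangent p (nabla p v Y);
  connection_smooth : forall X Y, smooth_vfield X -> smooth_vfield Y ->
    smooth_vfield (fun p => nabla p (X p) Y);
  connection_linear : forall p (a : R) u v Y,
    tangent p u -> tangent p v -> smooth_vfield Y ->
    nabla p (a *: u + v) Y = a *: nabla p u Y + nabla p v Y;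
  connection_add : forall p v Y Z,
    tangent p v -> smooth_vfield Y -> smooth_vfield Z ->
    nabla p v (fun q => Y q + Z q) = nabla p v Y + nabla p v Z;
  connection_leibniz : forall p v (f : M -> R) Y,
    tangent p v -> smooth_fun f -> smooth_vfield Y ->
    nabla p v (fun q => f q *: Y q) = v f *: Y p + f p *: nabla p v Y
}.

Record is_levi_civita (g : M -> functional M R -> functional M R -> R)
    (nabla : M -> functional M R -> vfield M R -> functional M R) : Prop :=
  IsLeviCivita {
  lc_connection : is_connection nabla;
  lc_torsion_free : forall X Y, smooth_vfield X -> smooth_vfield Y ->
    forall p, nabla p (X p) Y - nabla p (Y p) X = lie_bracket X Y p;
  lc_metric : forall p v Y Z,
    tangent p v -> smooth_vfield Y -> smooth_vfield Z ->
    v (fun q => g q (Y q) (Z q)) =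
      g p (nabla p v Y) (Z p) + g p (Y p) (nabla p v Z)
}.

End Tangent.

(* The Levi-Civita connection is uniquely determined by the metric (on smooth
   fields, the only arguments on which the value of [nabla] is meaningful). *)
Record riemannian (R : realType) (n : nat) := Riemannian {
  mfd :> manifold R n;
  metric : mfd -> functional mfd R -> functional mfd R -> R;
  metricP : is_metric metric;
  nabla : mfd -> functional mfd R -> vfield mfd R -> functional mfd R;
  nablaP : is_levi_civita metric nabla
}.

Section Orthogonal.
Context {R : realType} {m : nat} {M : riemannian R m}.

Definition perp (E : M -> set (functional M R)) :
    M -> set (functional M R) :=
  fun p => [set v | tangent p v /\ forall w, E p w -> metric p v w = 0].

End Orthogonal.

Section Geodesics.
Context {R : realType} {m : nat} {M : riemannian R m}.
Variables (I : set R) (gamma : R -> M).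

Definition field_along_curve (W : R -> functional M R) : Prop :=
  (forall t, I t -> tangent (gamma t) (W t)) /\
  (forall f : M -> R, smooth_fun f ->
     smooth_on (I : set R^o) (fun t : R^o => W t f : R^o)).

(* D is the covariant derivative D/dt along gamma, i.e. the unique operator
   with these properties. *)
Record is_covariant_derivative
    (D : (R -> functional M R) -> R -> functional M R) : Prop :=
  IsCovariantDerivative {
  cd_field : forall W, field_along_curve W -> field_along_curve (D W);
  cd_add : forall W W', field_along_curve W -> field_along_curve W' ->
    forall t, I t -> D (fun s => W s + W' s) t = D W t + D W' t;
  cd_leibniz : forall (a : R -> R) W,
    smooth_on (I : set R^o) (a : R^o -> R^o) -> field_along_curve W ->
    forall t, I t ->
    D (fun s => a s *: W s) t =
      derive1 (a : R -> R^o) t *: W t + a t *: D W t;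
  cd_restrict : forall Y : vfield M R, smooth_vfield Y -> forall t, I t ->
    D (fun s => Y (gamma s)) t = nabla (gamma t) (velocity gamma t) Y
}.

Definition is_geodesic (D : (R -> functional M R) -> R -> functional M R) :
    Prop :=
  forall t, I t -> D (velocity gamma) t = 0.

End Geodesics.

Section RiemannianMaps.
Context {R : realType} {m n : nat} {M : riemannian R m} {N : riemannian R n}.
Variable F : M -> N.

(* F_* *)
Definition tangent_map (v : functional M R) : functional N R := fun f =>
  if `[< smooth_fun f >] then v (f \o F) else 0.

Definition ker_tangent_map (p : M) : set (functional M R) :=
  [set v | tangent p v /\ tangent_map v = 0].

Definition range_tangent_map (p : M) : set (functional N R) :=
  tangent_map @` [set v | tangent p v].

Definition constant_rank (r : nat) : Prop :=
  forall p : M, exists e : 'I_r -> functional N R, is_basis (range_tangent_map p) e.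

Definition riemannian_map : Prop :=
  forall (p : M) x y, perp ker_tangent_map p x -> perp ker_tangent_map p y ->
    metric (F p) (tangent_map x) (tangent_map y) = metric p x y.

(* range F_* viewed as a distribution on N *)
Definition range_distribution (E : N -> set (functional N R)) : Prop :=
  subbundle E /\ forall p : M, E (F p) = range_tangent_map p.

(* *F_* at p *)
Definition adjoint_map (p : M) (w : functional N R) : functional M R :=
  xget 0 [set u | tangent p u /\
    forall x, tangent p x -> metric p x u = metric (F p) (tangent_map x) w].

(* smooth sections of the pullback bundle of TN by F *)
Definition field_along (W : M -> functional N R) : Prop :=
  (forall p, tangent (F p) (W p)) /\
  (forall f : N -> R, smooth_fun f -> smooth_fun (fun p => W p f)).

(* DF is the pullback by F of the Levi-Civita connection of N, i.e. the unique
   connection on the pullback of TN satisfying [pc_restrict]. *)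
Record is_pullback_connection
    (DF : M -> functional M R -> (M -> functional N R) -> functional N R) :
    Prop := IsPullbackConnection {
  pc_tangent : forall p v W, tangent p v -> field_along W ->
    tangent (F p) (DF p v W);
  pc_smooth : forall X W, smooth_vfield X -> field_along W ->
    field_along (fun p => DF p (X p) W);
  pc_linear : forall p (a : R) u v W,
    tangent p u -> tangent p v -> field_along W ->
    DF p (a *: u + v) W = a *: DF p u W + DF p v W;
  pc_add : forall p v W W', tangent p v -> field_along W -> field_along W' ->
    DF p v (fun q => W q + W' q) = DF p v W + DF p v W';
  pc_leibniz : forall p v (f : M -> R) W,
    tangent p v -> smooth_fun f -> field_along W ->
    DF p v (fun q => f q *: W q) = v f *: W p + f p *: DF p v W;
  pc_restrict : forall p v (Y : vfield N R), tangent p v -> smooth_vfield Y ->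
    DF p v (fun q => Y (F q)) = nabla (F p) (tangent_map v) Y
}.

(* (nabla F_* )(x, Y) at p *)
Definition second_fundamental_form
    (DF : M -> functional M R -> (M -> functional N R) -> functional N R)
    (p : M) (x : functional M R) (Y : vfield M R) : functional N R :=
  DF p x (fun q => tangent_map (Y q)) - tangent_map (nabla p x Y).

End RiemannianMaps.

Section SemiInvariant.
Context {R : realType} {n : nat} {N : riemannian R n}.
Variable P : N -> functional N R -> functional N R.

Record is_kahler : Prop := IsKahler {
  kahler_tangent : forall p v, tangent p v -> tangent p (P p v);
  kahler_linear : forall p (a : R) u v, tangent p u -> tangent p v ->
    P p (a *: u + v) = a *: P p u + P p v;
  kahler_smooth : forall X, smooth_vfield X ->
    smooth_vfield (fun p => P p (X p));
  kahler_sqr : forall p v, tangent p v -> P p (P p v) = - v;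
  kahler_isometry : forall p u v, tangent p u -> tangent p v ->
    metric p (P p u) (P p v) = metric p u v;
  kahler_parallel : forall p v Y, tangent p v -> smooth_vfield Y ->
    nabla p v (fun q => P q (Y q)) = P p (nabla p v Y)
}.

(* E stands for the distribution range F_* on N. *)
Variables E D1 D2 : N -> set (functional N R).

Record semi_invariant : Prop := SemiInvariant {
  si_D1 : subbundle D1;
  si_D2 : subbundle D2;
  si_sum : forall p, E p = [set u + w | u in D1 p & w in D2 p];
  si_orth : forall p u w, D1 p u -> D2 p w -> metric p u w = 0;
  si_P_D1 : forall p, P p @` D1 p = D1 p;
  si_P_D2 : forall p, P p @` D2 p `<=` perp E p
}.

Definition PD2 (p : N) : set (functional N R) := P p @` D2 p.

(* orthogonal complement of P D2 in the orthogonal complement of E *)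
Definition eta_bundle (p : N) : set (functional N R) := perp E p `&` perp PD2 p.

Definition phi_op (p : N) (w : functional N R) : functional N R :=
  component_in (D1 p) (PD2 p) (P p w).

Definition omega_op (p : N) (w : functional N R) : functional N R :=
  component_in (PD2 p) (D1 p) (P p w).

Definition Bpart (p : N) (v : functional N R) : functional N R :=
  component_in (E p) (eta_bundle p) (P p v).

Definition Cpart (p : N) (v : functional N R) : functional N R :=
  component_in (eta_bundle p) (E p) (P p v).

(* S_V w, where - S_V w is the E-component of nabla_w V *)
Definition shape_op (p : N) (V : vfield N R) (w : functional N R) :
    functional N R :=
  - component_in (E p) (perp E p) (nabla p w V).

(* nabla^{F perp}_w V: used both for w in range F_* and w in its orthogonal
   complement *)
Definition nabla_perp (p : N) (w : functional N R) (V : vfield N R) :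
    functional N R :=
  component_in (perp E p) (E p) (nabla p w V).

Definition perp_totally_geodesic : Prop :=
  forall U V : vfield N R, is_section (perp E) U -> is_section (perp E) V ->
    forall p, nabla p (U p) V = nabla_perp p (U p) V.

End SemiInvariant.

(* Main.v *)
(* Near t in I the velocity of beta is the restriction of Z = F_*X + V, so its
   covariant derivative at t is nabla_Z Z. As P is parallel and injective, this
   vanishes iff nabla_Z (P Z) does, where P Z = phi F_*X + omega F_*X + B V + C V.
   Expanding gives eight terms, whose sum is the sum of the two left-hand sides.
   The first one is tangent to E = range F_*: for V orthogonal to E, nabla_V
   preserves E because it preserves its totally geodesic complement. The second
   one is orthogonal to E: the second fundamental form of a Riemannian map is
   normal, by the Koszul formula.
   The fields involved are smooth because the coefficients of a section in a local
   frame are obtained from its inner products with the frame by inverting the Gram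
   matrix; frames of TM exist by cutting off coordinate fields. *)
Require Import Defs.
From HB Require Import structures.
From mathcomp Require Import all_boot all_order all_algebra.
From mathcomp Require Import all_classical all_reals all_analysis.
From mathcomp Require Import ring lra.

Set Implicit Arguments.
Unset Strict Implicit.
Unset Printing Implicit Defensive.

Import Order.TTheory GRing.Theory Num.Theory.
Import numFieldNormedType.Exports.

Local Open Scope classical_set_scope.
Local Open Scope ring_scope.

(* mathcomp's [vector.coord] shadows the chart projection. *)
Local Notation coord := Defs.coord.

(** * Smooth functions on normed spaces *)

(** The operators of the statement are chosen pointwise by [xget], so neither their values nor the
    smoothness of the resulting fields is given: values come from uniqueness of a decomposition,
    smoothness from inner products in which the unknown part drops out. The delicate point of the
    Koszul argument is that the bracket of two horizontal fields need not be horizontal, whereas a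
    Riemannian map is only assumed to preserve products of two horizontal vectors. The isometry is
    therefore extended to pairs with a single horizontal member. Horizontal lifts come from the
    adjoint, a right inverse of F_* on the range, so every section of [E] has a lift related to it
    on all of [M]. The same right inverse turns the pullback derivative inside the second
    fundamental form into a derivative on [N]; the tangential terms subtracted in the second
    condition then cancel against those of the first, and twelve terms collapse to eight. *)

Section CkGeneral.
Context {R : realType} {V W : normedModType R}.
Implicit Types (f g : V -> W) (U : set V) (x v : V).

(** The difference [h] vanishes near [x], so the null map is its differential, and [g] is [f] plus a
    differentiable function. *)
Lemma near_eq_differentiable f g x :
  (\near x, f x = g x) -> differentiable f x -> differentiable g x.
Proof.
move=> fg df; pose h y := g y - f y.
suff dh : differentiable h x.
  have -> : g = f + h by apply/funext => y; rewrite /h/= addrC subrK.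
  exact: differentiableD.
have h0 : h \o shift x =o_ 0 (id : V -> V).
  apply/eqoP => e e0; near=> y => /=.
  have -> : h (y + x) = 0.
    rewrite /h; have -> : f (y + x) = g (y + x); last by rewrite subrr.
    near: y.
    by move: fg; rewrite (near_shift 0) /= subr0.
  by rewrite normr0 mulr_ge0// ltW.
pose z : {linear V -> W} := @GRing.null_fun V W.
have e : h \o shift x = cst (h x) + z +o_ 0 id.
  apply: eqaddoE; have -> : cst (h x) + z = 0 :> (V -> W).
    by apply/funext => y /=; rewrite /h (nbhs_singleton fg) subrr addr0.
  by rewrite add0r h0.
have c0 : continuous z by move=> y; exact: cst_continuous.
apply/diff_locallyP; rewrite (diff_unique c0 e); split => //.
Unshelve. all: by end_near. Qed.

(** On an open set, agreement passes to all directional derivatives. The calculus rules below rely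
    on this, since their derivative formulas hold only at points of [U]. *)
Lemma Ck_congr k U f g : open U -> (forall x, U x -> f x = g x) ->
  Ck k U f -> Ck k U g.
Proof.
move=> oU; elim: k f g => [|k IH] f g fg /=.
  move=> cf x Ux.
  have nfg : {near x, f =1 g} by near=> y; apply: fg; near: y; exact: open_nbhs_nbhs.
  apply: cvg_trans; last first.
    rewrite -(fg x Ux); exact: (cf x Ux).
  exact: near_eq_cvg.
have nfg x : U x -> \near x, f x = g x.
  by move=> Ux; near=> y; apply: fg; near: y; exact: open_nbhs_nbhs.
move=> [df Df]; split=> [x Ux|v].
  by apply: near_eq_differentiable (df x Ux); exact: nfg.
apply: IH (Df v) => x Ux; apply: near_eq_derive; exact: nfg.
Unshelve. all: by end_near. Qed.

Lemma Ck_sub k U U' f : U' `<=` U -> Ck k U f -> Ck k U' f.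
Proof.
move=> UU; elim: k f => [|k IH] f /= => [cf x /UU|[df Df]]; first exact: cf.
by split=> [x /UU|v]; [exact: df|exact: IH].
Qed.

Lemma Ck_local k U f :
  (forall x, U x -> exists2 U', U' x & Ck k U' f) -> Ck k U f.
Proof.
elim: k f => [|k IH] f /= H; first by move=> x /H[U' U'x]; apply.
split=> [x /H[U' U'x []]|v]; first by move=> + _; apply.
by apply: IH => x /H[U' U'x [_ Df]]; exists U'.
Qed.

(** Feeds the product and chain rules, where one factor stays undifferentiated and is used at the
    lower order. *)
Lemma CkW k U f : Ck k.+1 U f -> Ck k U f.
Proof.
elim: k f => [|k IH] f.
  by move=> [df _] x /df; exact: differentiable_continuous.
by move=> [df Df]; split=> // v; apply: IH.
Qed.

Lemma Ck_cst k U (a : W) : Ck k U (cst a : V -> W).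
Proof.
elim: k a => [|k IH] a /=; first by move=> x _; exact: cst_continuous.
split=> [x _|v]; first exact: differentiable_cst.
rewrite (_ : (fun x => _) = cst 0) //.
by apply/funext => x; rewrite derive_cst.
Qed.

Lemma CkD k U f g : open U -> Ck k U f -> Ck k U g -> Ck k U (fun x => f x + g x).
Proof.
move=> oU; elim: k f g => [|k IH] f g.
  by move=> cf cg x Ux; apply: cvgD; [exact: cf|exact: cg].
move=> [df Df] [dg Dg]; split=> [x Ux|v].
  by apply: differentiableD; [exact: df|exact: dg].
apply: (Ck_congr oU _ (IH _ _ (Df v) (Dg v))) => x Ux.
by rewrite deriveD//; apply: diff_derivable; [exact: df|exact: dg].
Qed.

End CkGeneral.

Section CkReal.
Context {R : realType} {V : normedModType R}.
Implicit Types (f g : V -> R^o) (U : set V) (x v : V).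

Lemma CkM k U f g : open U -> Ck k U f -> Ck k U g ->
  Ck k U (fun x => f x * g x : R^o).
Proof.
move=> oU; elim: k f g => [|k IH] f g.
  by move=> cf cg x Ux; apply: cvgM; [exact: cf|exact: cg].
move=> cf cg; have [df Df] := cf; have [dg Dg] := cg; split=> [x Ux|v].
  by apply: differentiableM; [exact: df|exact: dg].
apply: (Ck_congr oU _
  (CkD oU (IH _ _ (CkW cf) (Dg v)) (IH _ _ (CkW cg) (Df v)))) => x Ux.
by rewrite deriveM//; apply: diff_derivable; [exact: df|exact: dg].
Qed.

(** The derivative is [-1] times the square of the inverse itself, known at the lower order, times
    the derivative of [f]. *)
Lemma CkV k U f : open U -> (forall x, U x -> f x != 0) -> Ck k U f ->
  Ck k U (fun x => (f x)^-1 : R^o).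
Proof.
move=> oU f0; elim: k => [|k IH].
  by move=> cf x Ux; apply: cvgV; [exact: f0|exact: cf].
move=> cf; have [df Df] := cf; split=> [x Ux|v].
  by apply: differentiableV; [exact: df|exact: f0].
have Ci := IH (CkW cf).
have C1 : Ck k U (cst (-1) : V -> R^o) by exact: Ck_cst.
apply: (Ck_congr oU _ (CkM oU C1 (CkM oU (CkM oU Ci Ci) (Df v)))) => x Ux.
rewrite deriveV; [|exact: f0|exact: diff_derivable (df _ Ux)].
by rewrite /= mulN1r -mulNr expr2 invfM.
Qed.

End CkReal.

Section CkComp.
Context {R : realType} {V : normedModType R} {n : nat}.

Lemma Ck_coord k (U : set V) (g : V -> 'rV[R]_n) i : open U -> Ck k U g ->
  Ck k U (fun x => g x 0 i : R^o).
Proof.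
move=> oU; elim: k g => [|k IH] g.
  by move=> cg x Ux; exact: (continuous_comp (cg x Ux) (@coord_continuous _ _ _ 0 i _)).
move=> [dg Dg]; split=> [x Ux|v].
  exact: (differentiable_comp (dg x Ux) (differentiable_coord _ _ _)).
apply: (Ck_congr oU _ (IH _ (Dg v))) => x Ux.
by rewrite derive_mx ?mxE//; apply: diff_derivable; exact: dg.
Qed.

Lemma diff_coordE (f : 'rV[R]_n -> R^o) (a h : 'rV[R]_n) : differentiable f a ->
  'D_h f a = \sum_i h 0 i * 'D_(delta_mx 0 i) f a.
Proof.
move=> df; rewrite deriveE// [in LHS](row_sum_delta h) linear_sum/=.
by apply: eq_bigr => i _; rewrite linearZ/= deriveE.
Qed.

Lemma Ck_sum (T : Type) (s : seq T) k (U : set V) (f : T -> V -> R^o) : open U ->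
  (forall i, Ck k U (f i)) -> Ck k U (fun x => \sum_(i <- s) f i x).
Proof.
move=> oU Cf; elim: s => [|i s IH].
  by apply: (Ck_congr oU _ (Ck_cst k U 0)) => x _; rewrite big_nil.
by apply: (Ck_congr oU _ (CkD oU (Cf i) IH)) => x _; rewrite big_cons.
Qed.

(** In coordinates the chain rule is a sum of products of real functions: components of the
    derivative of [g], and partial derivatives of [f] composed with [g]. The induction hypothesis
    covers the latter. *)
Lemma Ck_comp k (U : set V) (U' : set 'rV[R]_n) (g : V -> 'rV[R]_n)
    (f : 'rV[R]_n -> R^o) : open U -> (forall x, U x -> U' (g x)) ->
  Ck k U g -> Ck k U' f -> Ck k U (fun x => f (g x)).
Proof.
move=> oU UU' ; elim: k f => [|k IH] f.
  by move=> cg cf x Ux; exact: (continuous_comp (cg x Ux) (cf _ (UU' _ Ux))).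
move=> cg cf; have [dg Dg] := cg; have [df Df] := cf; split=> [x Ux|v].
  exact: (differentiable_comp (dg x Ux) (df _ (UU' _ Ux))).
have H i : Ck k U (fun x => 'D_v g x 0 i *
    'D_(delta_mx 0 i) f (g x) : R^o).
  apply: (CkM oU (Ck_coord i oU (Dg v))).
  exact: (IH _ (CkW cg) (Df (delta_mx 0 i))).
apply: (Ck_congr oU _ (Ck_sum (index_enum _) oU H)) => x Ux.
rewrite (deriveE _ (differentiable_comp (dg x Ux) (df _ (UU' _ Ux)))).
have dfx := df _ (UU' _ Ux).
rewrite (diff_comp (dg x Ux) dfx) /=.
by rewrite -(deriveE _ (dg x Ux)) -(deriveE _ dfx) diff_coordE.
Qed.

End CkComp.

Lemma near_open (T : topologicalType) (x : T) (P : T -> Prop) :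
  (\forall y \near x, P y) -> exists A, [/\ open A, A x & forall y, A y -> P y].
Proof. move=> H; have : nbhs x P by exact: H.
by rewrite nbhsE => -[A [oA Ax] AP]; exists A; split. Qed.

(** * Smoothness at a point *)

Section SmoothAt.
Context {R : realType} {V W : normedModType R}.
Implicit Types (f g : V -> W) (U : set V) (x v : V).

Lemma smooth_at_congr f g x :
  (\near x, f x = g x) -> smooth_at x f -> smooth_at x g.
Proof.
move=> /near_open[A [oA Ax fg]] [U [oU Ux sf]].
exists (A `&` U); split=> //; first exact: openI.
move=> k; apply: (@Ck_congr _ _ _ k _ f); first exact: openI.
  by move=> y [/fg].
by apply: Ck_sub (sf k) => y [].
Qed.

Lemma smooth_on_smooth_at U f x : open U -> U x -> smooth_on U f -> smooth_at x f.
Proof. by exists U. Qed.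

Lemma smooth_onP U f : open U ->
  smooth_on U f <-> (forall x, U x -> smooth_at x f).
Proof.
move=> oU; split=> [sf x Ux|H k]; first exact: (@smooth_on_smooth_at U).
by apply: Ck_local => x /H[U' [_ U'x sf]]; exists U'.
Qed.

Lemma smooth_at_differentiable f x : smooth_at x f -> differentiable f x.
Proof. by move=> [U [_ Ux /(_ 1%N)[df _]]]; exact: df. Qed.

Lemma smooth_at_continuous f x : smooth_at x f -> {for x, continuous f}.
Proof. by move=> /smooth_at_differentiable; exact: differentiable_continuous. Qed.

Lemma smooth_at_derive f x v : smooth_at x f -> smooth_at x (fun y => 'D_v f y).
Proof.
by move=> [U [oU Ux sf]]; exists U; split=> // k; have [_] := sf k.+1; apply.
Qed.

Lemma smooth_at_cst x (a : W) : smooth_at x (fun _ : V => a).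
Proof. exists setT; split=> //; [exact: openT|move=> k; exact: Ck_cst]. Qed.

Lemma smooth_atD f g x :
  smooth_at x f -> smooth_at x g -> smooth_at x (fun y => f y + g y).
Proof.
move=> [A [oA Ax sf]] [B [oB Bx sg]]; exists (A `&` B); split=> //.
  exact: openI.
move=> k; apply: CkD; first exact: openI.
  by apply: Ck_sub (sf k) => y [].
by apply: Ck_sub (sg k) => y [].
Qed.

End SmoothAt.

Section SmoothAtReal.
Context {R : realType} {V : normedModType R}.
Implicit Types (f g : V -> R^o) (x v : V).

Lemma smooth_atM f g x :
  smooth_at x f -> smooth_at x g -> smooth_at x (fun y => f y * g y : R^o).
Proof.
move=> [A [oA Ax sf]] [B [oB Bx sg]]; exists (A `&` B); split=> //.
  exact: openI.
move=> k; apply: CkM; first exact: openI.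
  by apply: Ck_sub (sf k) => y [].
by apply: Ck_sub (sg k) => y [].
Qed.

Lemma smooth_atV f x :
  smooth_at x f -> f x != 0 -> smooth_at x (fun y => (f y)^-1 : R^o).
Proof.
move=> sf f0.
have : \forall y \near x, f y != 0.
  have H : nbhs (f x) [set y : R^o | y != 0].
    by apply: open_nbhs_nbhs; split=> //; exact: open_neq.
  exact: (smooth_at_continuous sf H).
move=> /near_open[A [oA Ax nf]].
have [B [oB Bx sfB]] := sf; exists (A `&` B); split=> //.
  exact: openI.
move=> k; apply: CkV; first exact: openI.
  by move=> y [/nf].
by apply: Ck_sub (sfB k) => y [].
Qed.

Lemma Ck_comp1 k (U : set V) (U' : set R^o) (g : V -> R^o) (f : R^o -> R^o) :
  open U -> (forall x, U x -> U' (g x)) ->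
  Ck k U g -> Ck k U' f -> Ck k U (fun x => f (g x)).
Proof.
move=> oU UU' ; elim: k f => [|k IH] f.
  by move=> cg cf x Ux; exact: (continuous_comp (cg x Ux) (cf _ (UU' _ Ux))).
move=> cg cf; have [dg Dg] := cg; have [df Df] := cf; split=> [x Ux|v].
  exact: (differentiable_comp (dg x Ux) (df _ (UU' _ Ux))).
have H := CkM oU (Dg v) (IH _ (CkW cg) (Df 1)).
apply: (Ck_congr oU _ H) => x Ux.
have dfx := df _ (UU' _ Ux).
rewrite (deriveE _ (differentiable_comp (dg x Ux) dfx)).
rewrite (diff_comp (dg x Ux) dfx) /=.
rewrite -(deriveE _ (dg x Ux)).
by rewrite -[X in _ = 'd f (g x) X]mulr1 -[_ * 1]/(_ *: (1 : R^o)) linearZ/= -deriveE.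
Qed.

Lemma smooth_at_comp1 (f : R^o -> R^o) g x :
  smooth_at x g -> smooth_at (g x) f -> smooth_at x (fun y => f (g y)).
Proof.
move=> sg [B [oB Bx sf]].
have : \forall y \near x, B (g y).
  have H : nbhs (g x) B by exact: open_nbhs_nbhs.
  exact: (smooth_at_continuous sg H).
move=> /near_open[A [oA Ax AB]].
have [C [oC Cx sgC]] := sg; exists (A `&` C); split=> //; first exact: openI.
move=> k; apply: Ck_comp1 (sf k); first exact: openI.
  by move=> y [/AB].
by apply: Ck_sub (sgC k) => y [].
Qed.

Lemma smooth_at_sum (T : Type) (s : seq T) (f : T -> V -> R^o) x :
  (forall i, smooth_at x (f i)) -> smooth_at x (fun y => \sum_(i <- s) f i y : R^o).
Proof.
move=> sf; elim: s => [|i s IH].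
  by under eq_fun do rewrite big_nil; exact: smooth_at_cst.
by under eq_fun do rewrite big_cons; exact: smooth_atD.
Qed.

End SmoothAtReal.

Section SmoothAtComp.
Context {R : realType} {V : normedModType R} {n : nat}.

Lemma smooth_at_comp (f : 'rV[R]_n -> R^o) (g : V -> 'rV[R]_n) x :
  smooth_at x g -> smooth_at (g x) f -> smooth_at x (fun y => f (g y)).
Proof.
move=> sg [B [oB Bx sf]].
have : \forall y \near x, B (g y).
  have H : nbhs (g x) B by exact: open_nbhs_nbhs.
  exact: (smooth_at_continuous sg H).
move=> /near_open[A [oA Ax AB]].
have [C [oC Cx sgC]] := sg; exists (A `&` C); split=> //; first exact: openI.
move=> k; apply: Ck_comp (sf k); first exact: openI.
  by move=> y [/AB].
by apply: Ck_sub (sgC k) => y [].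
Qed.

Lemma smooth_at_coord (x : 'rV[R]_n) i :
  smooth_at x (fun y : 'rV[R]_n => y 0 i : R^o).
Proof.
exists setT; split=> //; first exact: openT.
move=> k; apply: Ck_coord; first exact: openT.
case: k => [|k]; first by move=> y _; exact: cvg_id.
split=> [y _|v]; first by have [] := is_diff_id y.
rewrite (_ : (fun _ => _) = cst v); first exact: Ck_cst.
by apply/funext => y; rewrite derive_id.
Qed.

Lemma derive_coord (x v : 'rV[R]_n) i :
  'D_v (fun y : 'rV[R]_n => y 0 i : R^o) x = v 0 i.
Proof.
have := @derive_mx R _ 1 n id x v (@derivable_id _ _ x v).
by rewrite derive_id => /matrixP/(_ 0 i); rewrite !mxE.
Qed.

End SmoothAtComp.

Lemma smooth_at_id (R : realType) (x : R^o) : smooth_at x (fun y : R^o => y).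
Proof.
exists setT; split=> //; first exact: openT.
case=> [|k]; first by move=> y _; exact: cvg_id.
split=> [y _|v]; first by have [] := is_diff_id y.
rewrite (_ : (fun _ => _) = cst v); first exact: Ck_cst.
by apply/funext => y; rewrite derive_id.
Qed.

(** * A smooth cutoff function *)

Section Flat.
Context {R : realType}.
Implicit Types (f : R^o -> R^o) (x : R).

Lemma CkS_is_derive k (U : set R^o) (f f' : R^o -> R^o) : open U ->
  (forall x, U x -> is_derive (x : R^o) 1 f (f' x)) ->
  Ck k U f' -> Ck k.+1 U f.
Proof.
move=> oU df Cf'.
have dfx x : U x -> differentiable f x.
  by move=> Ux; apply/derivable1_diffP; have [] := df x Ux.
split=> // v; apply: (Ck_congr oU _ (CkM oU (Ck_cst k U v) Cf')) => x Ux.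
rewrite deriveE; last exact: dfx.
rewrite -[X in _ = 'd f x X]mulr1 -[_ * 1]/(_ *: (1 : R^o)) linearZ/= -deriveE; last exact: dfx.
by have [_ ->] := df x Ux.
Qed.

(* The powers make the family closed under differentiation. *)
Definition flat n (x : R^o) : R^o :=
  if 0 < x then x^-1 ^+ n * expR (- x^-1) else 0.

Lemma flat_ge0 n x : 0 <= flat n x.
Proof.
rewrite /flat; case: ifPn => // x0.
by rewrite mulr_ge0 ?expR_ge0// exprn_ge0// invr_ge0 ltW.
Qed.

Lemma flat_gt0 n x : 0 < x -> 0 < flat n x.
Proof. by move=> x0; rewrite /flat x0 mulr_gt0 ?expR_gt0// exprn_gt0// invr_gt0. Qed.

(** With y the inverse of x, this is the exponential series bounded below by its term of degree n +
    2. A quadratic bound is what differentiability at 0 requires. *)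
Lemma flat_le n x : flat n x <= n.+2`!%:R * x ^+ 2.
Proof.
rewrite /flat; case: ifPn => [x0|_]; last by rewrite mulr_ge0// sqr_ge0.
set y := x^-1; have y0 : 0 < y by rewrite invr_gt0.
rewrite expRN ler_pdivrMr ?expR_gt0//.
have -> : x ^+ 2 = (y ^+ 2)^-1 by rewrite exprVn invrK.
have fn0 : (0 : R) < n.+2`!%:R by rewrite ltr0n fact_gt0.
have := @expR_ge1Dxn R y n.+1 (ltW y0).
move=> /(le_trans _) H.
have {}H : y ^+ n.+2 / n.+2`!%:R <= expR y by apply: H; rewrite lerDr.
have -> : y ^+ n = n.+2`!%:R / y ^+ 2 * (y ^+ n.+2 / n.+2`!%:R).
  rewrite -addn2 exprD; field.
  by rewrite !pnatr_eq0 -!lt0n ?fact_gt0 lt0r_neq0.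
by rewrite ler_wpM2l// divr_ge0// ?ler0n ?sqr_ge0.
Qed.

Lemma is_derive_flat n x :
  is_derive (x : R^o) 1 (flat n) (flat n.+2 x - n%:R * flat n.+1 x).
Proof.
have [x0|x0|x0] := ltgtP x 0.
- rewrite /flat ltNge (ltW x0)/= mulr0 subr0.
  apply: (near_eq_is_derive (f := cst 0)).
  near=> y; have y0 : y < 0 by near: y; exact: lt_nbhsl.
  by rewrite /flat/= ltNge (ltW y0).
- rewrite /flat x0.
  have xn0 : x != 0 by rewrite gt_eqF.
  have dV : is_derive (x : R^o) 1 (fun y : R^o => y^-1 : R^o) (- x ^- 2).
    have d := @derivable_id R R^o x 1.
    split; first exact: (@derivableV R R^o id x 1 xn0 d).
    rewrite (@deriveV R R^o id x 1 xn0 d) derive_id/=.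
    by rewrite /GRing.scale/= mulr1.
  have dE : is_derive (x : R^o) 1 (fun y : R^o => expR (- y^-1) : R^o)
      (x ^- 2 * expR (- x^-1)).
    have [h1 h2] := @is_derive1_comp R expR (fun y => - y^-1) x _ _
      (is_derive_expR _) (is_deriveN dV).
    by split; [exact: h1|rewrite [LHS]h2 opprK /GRing.scale/= mulrC].
  have dX := is_deriveX n dV.
  have := is_deriveM dX dE.
  move=> [d1 d2]; apply: (@near_eq_is_derive _ _ _
    (fun y : R^o => y^-1 ^+ n * expR (- y^-1) : R^o)).
    near=> y; have y0 : 0 < y by near: y; exact: lt_nbhsr.
    by rewrite /flat/= y0.
  have fE : (fun y : R^o => y^-1 ^+ n * expR (- y^-1) : R^o) =
      (fun y : R^o => y^-1 : R^o) ^+ n * (fun y : R^o => expR (- y^-1) : R^o).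
    by apply/funext => y; rewrite /= exprfctE.
  rewrite fE; split; first exact: d1.
  rewrite [LHS]d2 /= /GRing.scale/=.
  (* The power rule lowers a natural exponent by one, so the exponent 0 is treated apart. *)
  case: n {dX d1 d2 fE} => [|n].
    by rewrite exprfctE !expr0 mulr0n !mul0r !mulr0 !addr0 subr0 mul1r !exprVn.
  rewrite exprfctE /= -!exprVn; set c := n.+1%:R; set y := x^-1; set e := expR _.
  by rewrite !(exprS y); ring.
- subst x; rewrite /flat ltxx mulr0 subr0.
  (* At 0 the quadratic bound makes the difference quotient at most a constant times the absolute
     value of [h]. *)
  suff H : (fun h : R => h^-1 *: (flat n (h *: 1 + 0) - flat n 0)) @ 0^' --> (0 : R).
    split; first by apply/cvg_ex; exists 0.
    exact: cvg_lim H.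
  apply/cvgrPdist_le => e e0.
  near=> h.
  have h0 : h != 0 by near: h; exact: nbhs_dnbhs_neq.
  rewrite sub0r normrN addr0 /flat ltxx subr0 -/(flat n _).
  rewrite /GRing.scale/= mulr1 normrM normfV.
  rewrite ger0_norm -/(flat n h); last exact: flat_ge0.
  rewrite mulrC ler_pdivrMr ?normr_gt0//.
  apply: le_trans (flat_le n h) _.
  rewrite -real_normK ?num_real// expr2 mulrA ler_wpM2r ?normr_ge0//.
  have fn0 : (0 : R) < n.+2`!%:R by rewrite ltr0n fact_gt0.
  rewrite mulrC -ler_pdivlMr//.
  near: h; apply: dnbhs0_le; exact: divr_gt0.
Unshelve. all: by end_near. Qed.

Lemma Ck_flat k n : Ck k setT (flat n).
Proof.
elim: k n => [|k IH] n.
  move=> x _; apply: differentiable_continuous.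
  by apply/derivable1_diffP; have [] := is_derive_flat n x.
apply: (CkS_is_derive openT (fun x _ => is_derive_flat n x)).
have := CkD openT (IH n.+2) (CkM openT (Ck_cst k setT (- n%:R : R^o)) (IH n.+1)).
by apply: Ck_congr; [exact: openT|move=> x _ /=; rewrite mulNr].
Qed.

Lemma smooth_at_flat n (x : R^o) : smooth_at x (flat n).
Proof. by exists setT; split=> //; [exact: openT|move=> k; exact: Ck_flat]. Qed.

(** A smooth step from 1 down to 0. The arguments [2 - x] and [x - 1] add up to 1, so one of them is
    positive and the denominator never vanishes. *)
Definition cutoff (x : R^o) : R^o := flat 0 (2 - x) / (flat 0 (2 - x) + flat 0 (x - 1)).

Lemma cutoff1 x : x <= 1 -> cutoff x = 1.
Proof.
move=> x1; rewrite /cutoff [flat 0 (x - 1)]/flat subr_gt0 ltNge x1/= addr0 divff//.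
by rewrite gt_eqF// flat_gt0//; lra.
Qed.

Lemma cutoff0 x : 2 <= x -> cutoff x = 0.
Proof. by move=> x1; rewrite /cutoff /flat subr_gt0 ltNge x1/= mul0r. Qed.

Lemma smooth_at_cutoff (x : R^o) : smooth_at x cutoff.
Proof.
have s1 : smooth_at x (fun y : R^o => flat 0 (2 - y) : R^o).
  apply: (@smooth_at_comp1 _ _ (flat 0)); last exact: smooth_at_flat.
  apply: smooth_atD; first exact: smooth_at_cst.
  have := smooth_atM (smooth_at_cst x (-1 : R^o)) (smooth_at_id x).
  by apply: smooth_at_congr; near=> y; rewrite mulN1r.
have s2 : smooth_at x (fun y : R^o => flat 0 (y - 1) : R^o).
  apply: (@smooth_at_comp1 _ _ (flat 0)); last exact: smooth_at_flat.
  by apply: smooth_atD; [exact: smooth_at_id|exact: smooth_at_cst].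
apply: smooth_atM => //; apply: smooth_atV; first exact: smooth_atD.
rewrite gt_eqF//; have [x2|x2] := ltP x 2.
  by rewrite ltr_pwDl ?flat_ge0// flat_gt0//; lra.
by rewrite ltr_pwDr ?flat_ge0// flat_gt0//; lra.
Unshelve. all: by end_near. Qed.

End Flat.

(** * Charts and tangent vectors *)

Section Charts.
Context {R : realType} {m : nat} {M : manifold R m}.
Implicit Types (p q : M) (c : chart M 'rV[R]_m) (f h : M -> R).

Lemma near_param c p (P : M -> Prop) : atlas c -> chart_dom c p ->
  (\forall q \near p, P q) -> \forall y \near coord c p, P (param c y).
Proof.
move=> ac cp nP; have pc := atlas_chart ac.
have H : nbhs (param c (coord c p)) P by rewrite (chart_coordK pc cp).
exact: (chart_param_cont pc cp H).
Qed.

Lemma near_coord c p (P : 'rV[R]_m -> Prop) : atlas c -> chart_dom c p ->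
  (\forall y \near coord c p, P y) -> \forall q \near p, P (coord c q).
Proof. by move=> ac cp nP; exact: (chart_coord_cont (atlas_chart ac) cp nP). Qed.

Lemma near_chart_dom c p : atlas c -> chart_dom c p ->
  \forall q \near p, chart_dom c q.
Proof.
by move=> ac cp; apply: open_nbhs_nbhs; split=> //; exact: chart_dom_open (atlas_chart ac).
Qed.

Lemma near_paramK c p : atlas c -> chart_dom c p ->
  \forall y \near coord c p, chart_dom c (param c y) /\ coord c (param c y) = y.
Proof.
move=> ac cp; near=> y.
have : (coord c @` chart_dom c) y.
  near: y; apply: open_nbhs_nbhs; split; last by exists p.
  exact: chart_img_open (atlas_chart ac).
by move=> [q cq <-]; rewrite (chart_coordK (atlas_chart ac)).
Unshelve. all: by end_near. Qed.

Lemma open_chart_img c (A : set M) : atlas c -> open A ->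
  open (coord c @` (chart_dom c `&` A)).
Proof.
move=> ac oA; rewrite openE => _ [p [cp Ap] <-].
rewrite /interior/=; have nA : \forall q \near p, A q by exact: open_nbhs_nbhs.
near=> y; exists (param c y).
  split; last by near: y; exact: near_param.
  by have [] : chart_dom c (param c y) /\ coord c (param c y) = y by near: y; exact: near_paramK.
by have [] : chart_dom c (param c y) /\ coord c (param c y) = y by near: y; exact: near_paramK.
Unshelve. all: by end_near. Qed.

Lemma smooth_transition c c' p : atlas c -> atlas c' ->
  chart_dom c p -> chart_dom c' p ->
  smooth_at (coord c p) (coord c' \o param c).
Proof.
move=> ac ac' cp cp'; apply: smooth_on_smooth_at (atlas_compat ac ac').
  by apply: open_chart_img => //; exact: chart_dom_open (atlas_chart ac').
by exists p.
Qed.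

(** [smooth_fun] is this property at every point. The pointwise form is needed for functions known
    to be smooth only on a chart domain or near a point. *)
Definition smooth_fun_at p h := exists c, [/\ atlas c, chart_dom c p &
    smooth_at (coord c p) (h \o param c : 'rV[R]_m -> R^o)].

(** Smoothness of the transition maps frees the choice of chart. *)
Lemma smooth_fun_at_chart c p h : atlas c -> chart_dom c p ->
  smooth_fun_at p h -> smooth_at (coord c p) (h \o param c : 'rV[R]_m -> R^o).
Proof.
move=> ac cp [c' [ac' cp' sh]].
have st := smooth_transition ac ac' cp cp'.
have sh' : smooth_at ((coord c' \o param c) (coord c p)) (h \o param c' : 'rV[R]_m -> R^o).
  by rewrite /= (chart_coordK (atlas_chart ac) cp).
have := smooth_at_comp st sh'; apply: smooth_at_congr.
near=> y => /=; rewrite (chart_coordK (atlas_chart ac'))//.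
by near: y; apply: (near_param ac cp); exact: near_chart_dom.
Unshelve. all: by end_near. Qed.

Lemma smooth_fun_at_congr p f h : (\forall q \near p, f q = h q) ->
  smooth_fun_at p f -> smooth_fun_at p h.
Proof.
move=> fh [c [ac cp sf]]; exists c; split=> //.
exact: (smooth_at_congr (near_param ac cp fh) sf).
Qed.

Lemma smooth_fun_at_cst p (a : R) : smooth_fun_at p (fun=> a).
Proof.
have [c ac cp] := atlas_cover p; exists c; split=> //; exact: smooth_at_cst.
Qed.

Lemma smooth_fun_atD p f h :
  smooth_fun_at p f -> smooth_fun_at p h -> smooth_fun_at p (fun q => f q + h q).
Proof.
move=> [c [ac cp sf]] sh; exists c; split=> //.
exact: smooth_atD sf (smooth_fun_at_chart ac cp sh).
Qed.

Lemma smooth_fun_atM p f h :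
  smooth_fun_at p f -> smooth_fun_at p h -> smooth_fun_at p (fun q => f q * h q).
Proof.
move=> [c [ac cp sf]] sh; exists c; split=> //.
exact: smooth_atM sf (smooth_fun_at_chart ac cp sh).
Qed.

Lemma smooth_fun_atV p f :
  smooth_fun_at p f -> f p != 0 -> smooth_fun_at p (fun q => (f q)^-1).
Proof.
move=> [c [ac cp sf]] f0; exists c; split=> //.
by apply: smooth_atV sf _; rewrite /= (chart_coordK (atlas_chart ac)).
Qed.

Lemma smooth_fun_at_sum (T : Type) (s : seq T) (P : pred T) (F : T -> M -> R) p :
  (forall i, P i -> smooth_fun_at p (F i)) ->
  smooth_fun_at p (fun q => \sum_(i <- s | P i) F i q).
Proof.
move=> sF; elim: s => [|i s IH].
  by under eq_fun do rewrite big_nil; exact: smooth_fun_at_cst.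
under eq_fun do rewrite big_cons; case Pi: (P i) => //; exact: (smooth_fun_atD (sF i Pi) IH).
Qed.

Lemma smooth_fun_at_prod (T : Type) (s : seq T) (F : T -> M -> R) p :
  (forall i, smooth_fun_at p (F i)) ->
  smooth_fun_at p (fun q => \prod_(i <- s) F i q).
Proof.
move=> sF; elim: s => [|i s IH].
  by under eq_fun do rewrite big_nil; exact: smooth_fun_at_cst.
by under eq_fun do rewrite big_cons; apply: smooth_fun_atM.
Qed.

End Charts.

Section TangentVectors.
Context {R : realType} {m : nat} {M : manifold R m}.
Implicit Types (p q : M) (c : chart M 'rV[R]_m) (f : M -> R).
Implicit Types (u v : functional M R) (X Y : vfield M R).

Definition coord_vector c p (h : 'rV[R]_m) : functional M R := fun f =>
  if `[< smooth_fun f >]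
  then 'D_h (f \o param c : 'rV[R]_m -> R^o) (coord c p) else 0.

Lemma coord_vector_lin c p (a : R) h k : atlas c -> chart_dom c p ->
  coord_vector c p (a *: h + k) = a *: coord_vector c p h + coord_vector c p k.
Proof.
move=> ac cp; apply/funext => f.
rewrite /coord_vector [RHS]/GRing.add/= [(_ *: _) f]/GRing.scale/=.
case: asboolP => [sf|_]; last by rewrite scaler0 addr0.
have df := smooth_at_differentiable (smooth_fun_at_chart ac cp (sf p)).
by rewrite !deriveE// linearP.
Qed.

Lemma coord_vector_tangent c p h : atlas c -> chart_dom c p ->
  tangent p (coord_vector c p h).
Proof. by move=> ac cp; exists c; split=> //; exists h. Qed.

(** [tangent] provides a chart of its own; the coordinates in the given chart are the image of the
    old ones under the derivative of the transition map. *)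
Lemma tangent_coord c p v : atlas c -> chart_dom c p -> tangent p v ->
  exists h, v = coord_vector c p h.
Proof.
move=> ac cp [c' [ac' cp' [h vE]]].
have st := smooth_transition ac' ac cp' cp.
exists ('D_h (coord c \o param c') (coord c' p)).
apply/funext => f; rewrite vE /coord_vector; case: asboolP => // sf.
have E : coord c p = (coord c \o param c') (coord c' p).
  by rewrite /= (chart_coordK (atlas_chart ac') cp').
have df := smooth_at_differentiable (smooth_fun_at_chart ac cp (sf p)).
have dt := smooth_at_differentiable st.
rewrite (deriveE _ df) (deriveE _ dt).
have := df; rewrite E => df'.
have /= <- := congr1 (@^~ h) (diff_comp dt df').
rewrite -deriveE; last exact: differentiable_comp.
apply: near_eq_derive; near=> y => /=; rewrite (chart_coordK (atlas_chart ac))//.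
by near: y; apply: (near_param ac' cp'); exact: near_chart_dom.
Unshelve. all: by end_near. Qed.

Lemma tangent_lin p (a : R) u v : tangent p u -> tangent p v ->
  tangent p (a *: u + v).
Proof.
have [c ac cp] := atlas_cover p => tu tv.
have [h ->] := tangent_coord ac cp tu; have [k ->] := tangent_coord ac cp tv.
by rewrite -coord_vector_lin//; exact: coord_vector_tangent.
Qed.

Lemma tangent0 p : tangent p 0.
Proof.
have [c ac cp] := atlas_cover p.
rewrite (_ : 0 = coord_vector c p 0); first exact: coord_vector_tangent.
by apply/funext => f; rewrite /coord_vector derive0; case: ifP.
Qed.

Lemma tangentD p u v : tangent p u -> tangent p v -> tangent p (u + v).
Proof. by move=> tu tv; rewrite -[u]scale1r; exact: tangent_lin. Qed.

Lemma tangentZ p (a : R) u : tangent p u -> tangent p (a *: u).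
Proof. by move=> tu; rewrite -[_ *: _]addr0; apply: tangent_lin => //; exact: tangent0. Qed.

Lemma tangentN p u : tangent p u -> tangent p (- u).
Proof. by move=> tu; rewrite -scaleN1r; exact: tangentZ. Qed.

Lemma tangentB p u v : tangent p u -> tangent p v -> tangent p (u - v).
Proof. by move=> tu tv; apply: tangentD => //; exact: tangentN. Qed.

Lemma tangent_sum p (T : Type) (s : seq T) (F : T -> functional M R) :
  (forall i, tangent p (F i)) -> tangent p (\sum_(i <- s) F i).
Proof.
move=> tF; elim: s => [|i s IH]; first by rewrite big_nil; exact: tangent0.
by rewrite big_cons; exact: tangentD.
Qed.

Lemma tangent_cst p v (a : R) : tangent p v -> v (fun=> a) = 0.
Proof.
move=> [c [_ _ [h ->]]]; case: asboolP => // _.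
by rewrite (_ : _ \o _ = cst (a : R^o)) ?derive_cst.
Qed.

Lemma smooth_vfield_lin (f : M -> R) X Y : smooth_fun f ->
  smooth_vfield X -> smooth_vfield Y -> smooth_vfield (fun q => f q *: X q + Y q).
Proof.
move=> sf [tX sX] [tY sY]; split=> [p|h sh p]; first exact: tangent_lin.
apply: smooth_fun_atD; last exact: sY.
by apply: smooth_fun_atM; [exact: sf|exact: sX].
Qed.

Lemma smooth_vfield0 : smooth_vfield (fun _ : M => 0).
Proof. by split=> [p|h sh p]; [exact: tangent0|exact: smooth_fun_at_cst]. Qed.

Lemma smooth_vfieldD X Y : smooth_vfield X -> smooth_vfield Y ->
  smooth_vfield (fun q => X q + Y q).
Proof.
move=> sX sY; have s1 : smooth_fun (fun _ : M => 1 : R) by move=> p; exact: smooth_fun_at_cst.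
by have := smooth_vfield_lin s1 sX sY; under eq_fun do rewrite scale1r.
Qed.

Lemma smooth_vfieldZ (f : M -> R) X : smooth_fun f -> smooth_vfield X ->
  smooth_vfield (fun q => f q *: X q).
Proof.
by move=> sf sX; have := smooth_vfield_lin sf sX smooth_vfield0; under eq_fun do rewrite addr0.
Qed.

Lemma smooth_vfieldB X Y : smooth_vfield X -> smooth_vfield Y ->
  smooth_vfield (fun q => X q - Y q).
Proof.
move=> sX sY; apply: smooth_vfieldD => //.
have s1 : smooth_fun (fun _ : M => -1 : R) by move=> p; exact: smooth_fun_at_cst.
by have := smooth_vfieldZ s1 sY; under eq_fun do rewrite scaleN1r.
Qed.

Lemma smooth_vfield_sum (T : Type) (s : seq T) (X : T -> vfield M R) :
  (forall i, smooth_vfield (X i)) -> smooth_vfield (fun q => \sum_(i <- s) X i q).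
Proof.
move=> sX; elim: s => [|i s IH].
  by under eq_fun do rewrite big_nil; exact: smooth_vfield0.
by under eq_fun do rewrite big_cons; exact: smooth_vfieldD.
Qed.

End TangentVectors.

(** * Bump functions and local frames *)

Section Frames.
Context {R : realType} {m : nat} {M : manifold R m}.
Implicit Types (p q : M) (c : chart M 'rV[R]_m).

(** Half the radius keeps a closed box inside the open ball. Closed boxes are wanted because they
    are compact. *)
Lemma nbhs_box (a : 'rV[R]_m) (A : set 'rV[R]_m) : nbhs a A ->
  exists2 r : R, 0 < r &
    [set y : 'rV[R]_m | forall i, y ord0 i \in `[a ord0 i - r, a ord0 i + r]] `<=` A.
Proof.
move=> /nbhs_ballP[e /= e0 eA]; exists (e / 2); first by rewrite divr_gt0.
move=> y /= yb; apply: eA; split=> // i j; rewrite (ord1 i) -ball_normE/=.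
have := yb j; rewrite in_itv/= => /andP[y1 y2].
rewrite distrC ltr_norml; lra.
Qed.

Lemma compact_box (a : 'rV[R]_m) (r : R) :
  compact [set y : 'rV[R]_m | forall i, y ord0 i \in `[a ord0 i - r, a ord0 i + r]].
Proof.
exact: (@rV_compact R m (fun i => [set` `[a ord0 i - r, a ord0 i + r]])
  (fun i => @segment_compact R _ _)).
Qed.

Lemma euclidean_bump (a : 'rV[R]_m) (r : R) : 0 < r ->
  exists b : 'rV[R]_m -> R^o, [/\ forall y, smooth_at y b,
    \forall y \near a, b y = 1 &
    forall y : 'rV[R]_m, ~ (forall i, y ord0 i \in `[a ord0 i - r, a ord0 i + r]) -> b y = 0].
Proof.
move=> r0.
(* The squared distance is scaled so that a single coordinate at distance [r] already contributes 2,
   the point from which [cutoff] is 0; at [a] the value 0 lies well below 1. *)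
pose u (y : 'rV[R]_m) : R^o := (\sum_i (y 0 i - a 0 i) * (y 0 i - a 0 i)) * (2 / r ^+ 2).
have r20 : 0 < 2 / r ^+ 2 by rewrite divr_gt0// exprn_gt0.
have su y : smooth_at y u.
  apply: smooth_atM; last exact: smooth_at_cst.
  apply: smooth_at_sum => i.
  by apply: smooth_atM; (apply: smooth_atD; [exact: smooth_at_coord|exact: smooth_at_cst]).
exists (fun y => cutoff (u y)); split=> [y||y].
- exact: smooth_at_comp1 (su y) (smooth_at_cutoff _).
- have H : nbhs (u a) [set t : R^o | t < 1].
    apply: open_nbhs_nbhs; split; first exact: open_lt.
    by rewrite /= /u big1 ?mul0r ?ltr01// => i _; rewrite subrr mul0r.
  near=> y; apply: cutoff1; apply: ltW.
  by near: y; exact: (smooth_at_continuous (su a) H).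
- move=> /existsNP[i /negP yi]; apply: cutoff0.
  rewrite /u -ler_pdivrMr// invf_div mulrCA divff// mulr1.
  apply: le_trans (_ : (y 0 i - a 0 i) * (y 0 i - a 0 i) <= _); last first.
    rewrite (bigD1 i)//= lerDl sumr_ge0// => j _; exact: sqr_ge0.
  rewrite -expr2 -(real_normK (num_real (y 0 i - a 0 i))).
  rewrite lerXn2r ?nnegrE ?normr_ge0 ?(ltW r0)//.
  move: yi; rewrite in_itv/= leNgt => yi; apply: ltW; rewrite ltNge; apply: contra yi.
  rewrite ler_norml => /andP[h1 h2]; apply/andP; split; first rewrite -leNgt; lra.
Unshelve. all: by end_near. Qed.

(** Extension by zero is smooth across the boundary of the chart because [chi] vanishes off the
    image [K] of a closed box: [K] is compact, hence closed as [M] is Hausdorff, and a point outside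
    the chart has a neighbourhood missing [K]. *)
Lemma chart_bump c p : atlas c -> chart_dom c p ->
  exists chi : M -> R, [/\ smooth_fun chi, \forall q \near p, chi q = 1,
    forall q, ~ chart_dom c q -> chi q = 0 &
    forall h : M -> R, (forall q, chart_dom c q -> smooth_fun_at q h) ->
      smooth_fun (fun q => chi q * h q)].
Proof.
move=> ac cp; have pc := atlas_chart ac.
have [|r r0 rO] := @nbhs_box (coord c p) (coord c @` chart_dom c).
  by apply: open_nbhs_nbhs; split; [exact: chart_img_open|exists p].
have [b [sb b1 b0]] := euclidean_bump (coord c p) r0.
set B := [set y : 'rV[R]_m | _] in rO.
pose K := param c @` B.
have cK : closed K.
  apply: compact_closed; first exact: manifold_hausdorff.
  apply: continuous_compact; last exact: compact_box.
  apply: continuous_in_subspaceT => y /set_mem/rO[q cq <-].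
  exact: chart_param_cont.
have KE q : chart_dom c q -> ~ K q -> b (coord c q) = 0.
  move=> cq Kq; apply: b0 => Bq; apply: Kq; exists (coord c q) => //.
  exact: chart_coordK.
pose chi q : R := if `[< chart_dom c q >] then b (coord c q) else 0.
have chi0 q : ~ K q -> chi q = 0.
  by move=> Kq; rewrite /chi; case: asboolP => // cq; exact: KE.
have schi q : chart_dom c q -> smooth_fun_at q chi.
  move=> cq; exists c; split=> //; apply: smooth_at_congr (sb (coord c q)).
  near=> y => /=.
  have [cy yK] : chart_dom c (param c y) /\ coord c (param c y) = y.
    by near: y; exact: near_paramK.
  by rewrite /chi asboolT// yK.
have ext h : (forall q, chart_dom c q -> smooth_fun_at q h) ->
    smooth_fun (fun q => chi q * h q).
  move=> sh q; have [cq|ncq] := pselect (chart_dom c q).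
    by apply: smooth_fun_atM; [exact: schi|exact: sh].
  apply: (smooth_fun_at_congr _ (smooth_fun_at_cst q 0)).
  have nK : ~ K q by move=> [y /rO[z cz <-] qE]; apply: ncq; rewrite -qE chart_coordK.
  near=> z; rewrite chi0 ?mul0r//.
  near: z; apply: open_nbhs_nbhs; split => //; exact: closed_openC.
exists chi; split=> //.
- have : smooth_fun (fun q => chi q * 1) by apply: ext => q _; exact: smooth_fun_at_cst.
  by under eq_fun do rewrite mulr1.
- near=> q; rewrite /chi asboolT; last by near: q; exact: near_chart_dom.
  by near: q; exact: (near_coord ac cp b1).
- by move=> q ncq; rewrite /chi asboolF.
Unshelve. all: by end_near. Qed.

(* Both the frame and its dual coordinates are cut off, since [smooth_vfield] and
   [smooth_fun] are global. *)
Lemma local_frame p : exists (e : 'I_m -> vfield M R) (y : 'I_m -> M -> R),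
  [/\ forall i, smooth_vfield (e i), forall i, smooth_fun (y i) &
   \forall q \near p,
     (forall v, tangent q v -> v = \sum_i v (y i) *: e i q) /\
     (forall i j, e i q (y j) = (i == j)%:R)].
Proof.
have [c ac cp] := atlas_cover p.
have [chi [schi chi1 chi0 ext]] := chart_bump ac cp.
pose y i q : R := chi q * coord c q 0 i.
pose e i : vfield M R := fun q f =>
  if `[< smooth_fun f >] then
    chi q * 'D_(delta_mx 0 i) (f \o param c : 'rV[R]_m -> R^o) (coord c q)
  else 0.
have sy i : smooth_fun (y i).
  apply: ext => q cq; exists c; split=> //.
  apply: smooth_at_congr (smooth_at_coord (coord c q) i).
  near=> z => /=; congr (_ 0 i).
  by have [_ ->] : chart_dom c (param c z) /\ coord c (param c z) = z;
    first by near: z; exact: near_paramK.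
have eE i q : chart_dom c q -> e i q = chi q *: coord_vector c q (delta_mx 0 i).
  move=> cq; apply/funext => f; rewrite /e /coord_vector [RHS]/GRing.scale/=.
  by case: ifP => // _; rewrite scaler0.
have se i : smooth_vfield (e i).
  split=> [q|f sf].
    have [cq|ncq] := pselect (chart_dom c q).
      by rewrite eE//; apply: tangentZ; exact: coord_vector_tangent.
    rewrite (_ : e i q = 0); first exact: tangent0.
    by apply/funext => f; rewrite /e chi0// mul0r; case: ifP.
  rewrite /e asboolT//; apply: ext => q cq; exists c; split=> //.
  have := smooth_at_derive (delta_mx 0 i) (smooth_fun_at_chart ac cq (sf q)).
  apply: smooth_at_congr; near=> z => /=; congr ('D_ _ _ _).
  by have [_ ->] : chart_dom c (param c z) /\ coord c (param c z) = z;
    first by near: z; exact: near_paramK.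
exists e, y; split=> //.
(* The functions [y i] get differentiated at [q], so [chi] must be 1 around [q] and not only at [q];
   an open set ensures this. *)
have [A [oA Ap A1]] := near_open chi1.
near=> q.
have Aq : A q by near: q; exact: open_nbhs_nbhs.
have cq : chart_dom c q by near: q; exact: near_chart_dom.
have cvy h i : coord_vector c q h (y i) = h 0 i.
  rewrite /coord_vector asboolT// -(derive_coord (coord c q) h i).
  apply: near_eq_derive; near=> z => /=.
  have Az : A (param c z) by near: z; apply: (near_param ac cq); exact: open_nbhs_nbhs.
  rewrite /y (A1 _ Az) mul1r; congr (_ 0 i).
  by have [_ ->] : chart_dom c (param c z) /\ coord c (param c z) = z;
    first by near: z; exact: near_paramK.
split=> [v tv|i j]; last first.
  by rewrite eE// (A1 _ Aq) scale1r cvy mxE eqxx eq_sym.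
have [h ->] := tangent_coord ac cq tv.
under eq_bigr do rewrite cvy eE// (A1 _ Aq) scale1r.
have {1}-> : h = \sum_i h 0 i *: delta_mx 0 i by exact: row_sum_delta.
elim: (index_enum _) => [|i s IH].
  rewrite !big_nil; apply/funext => f.
  by rewrite /coord_vector derive0; case: ifP.
by rewrite !big_cons coord_vector_lin// IH.
Unshelve. all: by end_near. Qed.

End Frames.

(** * Gram matrices and smooth sections *)

Section Gram.
Context {R : realType} {m : nat} {M : riemannian R m}.
Implicit Types (p q : M) (u v w : functional M R) (X Y Z : vfield M R).
Implicit Types (B : M -> set (functional M R)).

Lemma metricC p u v : tangent p u -> tangent p v -> metric p u v = metric p v u.
Proof. exact: (Defs.metric_sym (metricP M)). Qed.

Lemma metric_linl p (a : R) u v w : tangent p u -> tangent p v -> tangent p w ->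
  metric p (a *: u + v) w = a * metric p u w + metric p v w.
Proof. exact: (metric_linear (metricP M)). Qed.

Lemma metric0l p w : tangent p w -> metric p 0 w = 0.
Proof.
move=> tw; have t0 := tangent0 p.
have := metric_linl 1 t0 t0 tw; rewrite scaler0 addr0 mul1r => /eqP.
by rewrite -subr_eq0 opprD addrA subrr sub0r oppr_eq0 => /eqP.
Qed.

Lemma metricDl p u v w : tangent p u -> tangent p v -> tangent p w ->
  metric p (u + v) w = metric p u w + metric p v w.
Proof. by move=> tu tv tw; have := metric_linl 1 tu tv tw; rewrite scale1r mul1r. Qed.

Lemma metricZl p (a : R) u w : tangent p u -> tangent p w ->
  metric p (a *: u) w = a * metric p u w.
Proof.
move=> tu tw; have := metric_linl a tu (tangent0 p) tw.
by rewrite addr0 metric0l// addr0.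
Qed.

Lemma metricBl p u v w : tangent p u -> tangent p v -> tangent p w ->
  metric p (u - v) w = metric p u w - metric p v w.
Proof.
move=> tu tv tw; rewrite metricDl//; last exact: tangentN.
by rewrite -scaleN1r metricZl// mulN1r.
Qed.

Lemma metricBr p u v w : tangent p u -> tangent p v -> tangent p w ->
  metric p w (u - v) = metric p w u - metric p w v.
Proof.
move=> tu tv tw; rewrite metricC//; last exact: tangentB.
by rewrite metricBl// metricC// [metric p v w]metricC.
Qed.

Lemma metric_suml p (T : Type) (s : seq T) (a : T -> R) (e : T -> functional M R) w :
  (forall i, tangent p (e i)) -> tangent p w ->
  metric p (\sum_(i <- s) a i *: e i) w = \sum_(i <- s) a i * metric p (e i) w.
Proof.
move=> te tw; elim: s => [|i s IH]; first by rewrite !big_nil metric0l.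
rewrite !big_cons metric_linl ?IH//.
by apply: tangent_sum => j; exact: tangentZ.
Qed.

Lemma metric_eq0 p v : tangent p v -> metric p v v = 0 -> v = 0.
Proof.
move=> tv gv; apply: contrapT => /eqP v0.
by have := metric_pos (metricP M) tv (elimN eqP v0); rewrite gv ltxx.
Qed.

Definition independent k (s : 'I_k -> functional M R) :=
  forall a : 'I_k -> R, \sum_i a i *: s i = 0 -> forall i, a i = 0.

Definition gram p k (s : 'I_k -> functional M R) : 'M[R]_k :=
  \matrix_(i, j) metric p (s i) (s j).

(** A row killed by the Gram matrix gives a combination orthogonal to every [s i], hence to itself,
    and the metric is positive definite. *)
Lemma gram_unit p k (s : 'I_k -> functional M R) :
  (forall i, tangent p (s i)) -> independent s -> gram p s \in unitmx.
Proof.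
move=> ts si; rewrite -row_free_unit; apply: inj_row_free => a aG.
have gE j : metric p (\sum_i a 0 i *: s i) (s j) = 0.
  rewrite metric_suml//; have := congr1 (fun b : 'rV_k => b 0 j) aG.
  rewrite mxE [RHS]mxE => aGj; rewrite -[RHS]aGj.
  by apply: eq_bigr => i _; rewrite mxE.
have tu : tangent p (\sum_i a 0 i *: s i) by apply: tangent_sum => i; exact: tangentZ.
have : \sum_i a 0 i *: s i = 0.
  apply: (metric_eq0 tu); rewrite {1}metric_suml// big1// => i _.
  by rewrite metricC// gE mulr0.
by move=> /si a0; apply/rowP => i; rewrite a0 mxE.
Qed.

(** Solves the Gram system. Orthogonal projections, adjoints and horizontal lifts are all obtained
    by prescribing inner products in this way. *)
Lemma riesz p k (s : 'I_k -> functional M R) (b : 'I_k -> R) :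
  (forall i, tangent p (s i)) -> independent s ->
  exists a : 'I_k -> R, forall j, metric p (\sum_i a i *: s i) (s j) = b j.
Proof.
move=> ts si; exists (fun i => ((\row_j b j) *m invmx (gram p s)) 0 i) => j.
rewrite metric_suml//.
have := mulmxKV (gram_unit ts si) (\row_j b j).
move=> /(congr1 (fun c : 'rV_k => c 0 j)); rewrite [RHS]mxE => <-.
by rewrite [RHS]mxE; apply: eq_bigr => i _; rewrite [gram p s i j]mxE.
Qed.

Lemma smooth_fun_at_det p k (A : M -> 'M[R]_k) :
  (forall i j, smooth_fun_at p (fun q => A q i j)) ->
  smooth_fun_at p (fun q => \det (A q)).
Proof.
move=> sA; apply: smooth_fun_at_sum => s _; apply: smooth_fun_atM.
  exact: smooth_fun_at_cst.
by apply: smooth_fun_at_prod => i.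
Qed.

Lemma smooth_fun_at_invmx p k (A : M -> 'M[R]_k) i j :
  (forall i j, smooth_fun_at p (fun q => A q i j)) ->
  (\forall q \near p, A q \in unitmx) ->
  smooth_fun_at p (fun q => invmx (A q) i j).
Proof.
move=> sA uA.
(* Cramer's rule: determinant and cofactors are polynomials in the entries. [invmx] has this form
   only at invertible matrices, which is why invertibility is assumed near [p]. *)
apply: (@smooth_fun_at_congr _ _ _ _ (fun q => (\det (A q))^-1 * \adj (A q) i j)).
  near=> q; have uq : A q \in unitmx by near: q.
  by rewrite /invmx uq [RHS]mxE.
apply: smooth_fun_atM.
  apply: smooth_fun_atV; first exact: smooth_fun_at_det.
  by have := nbhs_singleton uA; rewrite unitmxE unitfE.
under eq_fun do rewrite mxE.
rewrite /cofactor; apply: smooth_fun_atM; first exact: smooth_fun_at_cst.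
apply: smooth_fun_at_det => i' j'.
by under eq_fun do rewrite !mxE; exact: sA.
Unshelve. all: by end_near. Qed.

(* The coefficients of U are recovered by the inverse of the Gram matrix. *)
Lemma smooth_of_metric p k (s : 'I_k -> vfield M R) (a : M -> 'I_k -> R)
    (U : vfield M R) (f : M -> R) :
  (forall i, smooth_vfield (s i)) ->
  (\forall q \near p, independent (s ^~ q) /\ U q = \sum_i a q i *: s i q) ->
  (forall j, smooth_fun_at p (fun q => metric q (U q) (s j q))) ->
  smooth_fun f -> smooth_fun_at p (fun q => U q f).
Proof.
move=> ss sU sb sf.
have sG i j : smooth_fun_at p (fun q => gram q (s ^~ q) i j).
  by under eq_fun do rewrite mxE; exact: (metric_smooth (metricP M) (ss i) (ss j)).
have uG : \forall q \near p, gram q (s ^~ q) \in unitmx.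
  near=> q; apply: gram_unit => [i|]; first by have [] := ss i.
  by have [] : independent (s ^~ q) /\ U q = \sum_i a q i *: s i q by near: q.
pose b q : 'rV[R]_k := \row_j metric q (U q) (s j q).
apply: (@smooth_fun_at_congr _ _ _ _
  (fun q => \sum_i (b q *m invmx (gram q (s ^~ q))) 0 i * s i q f)); last first.
  apply: smooth_fun_at_sum => i _; apply: smooth_fun_atM; last by have [_] := ss i; apply.
  under eq_fun do rewrite mxE; apply: smooth_fun_at_sum => j _.
  apply: smooth_fun_atM; last exact: smooth_fun_at_invmx.
  by under eq_fun do rewrite mxE.
near=> q.
have [si UE] : independent (s ^~ q) /\ U q = \sum_i a q i *: s i q by near: q.
have ts i : tangent q (s i q) by have [] := ss i.
have bE : b q = \row_i a q i *m gram q (s ^~ q).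
  apply/rowP => j; rewrite !mxE UE metric_suml//.
  by apply: eq_bigr => i _; rewrite !mxE.
rewrite bE mulmxK; last exact: gram_unit.
rewrite UE; elim: (index_enum _) => [|i l IH]; first by rewrite !big_nil.
by rewrite !big_cons IH mxE.
Unshelve. all: by end_near. Qed.

Lemma basis_tangent p B k (e : 'I_k -> functional M R) v :
  is_basis (B p) e -> (forall i, tangent p (e i)) -> B p v -> tangent p v.
Proof.
by move=> [-> _] te [a _ <-]; apply: tangent_sum => i; exact: tangentZ.
Qed.

Lemma subbundle_basis B p : subbundle B ->
  exists k (e : 'I_k -> functional M R), (forall i, tangent p (e i)) /\ is_basis (B p) e.
Proof.
move=> /(_ p)[k [s [ss /nbhs_singleton bs]]]; exists k, (s ^~ p); split=> // i.
by have [] := ss i.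
Qed.

Lemma subbundle_tangent B p v : subbundle B -> B p v -> tangent p v.
Proof. by move=> /(subbundle_basis p)[k [e [te be]]]; exact: (basis_tangent be te). Qed.

Lemma basis_lin p B k (e : 'I_k -> functional M R) (a : R) u v :
  is_basis (B p) e -> B p u -> B p v -> B p (a *: u + v).
Proof.
move=> [-> _] [b _ <-] [c _ <-]; exists (fun i => a * b i + c i) => //.
rewrite scaler_sumr -big_split/=; apply: eq_bigr => i _.
by rewrite scalerDl scalerA.
Qed.

Lemma subbundle_lin B p (a : R) u v : subbundle B -> B p u -> B p v -> B p (a *: u + v).
Proof. by move=> /(subbundle_basis p)[k [e [te be]]]; exact: (basis_lin _ be). Qed.

Lemma subbundle0 B p : subbundle B -> B p 0.
Proof.
move=> /(subbundle_basis p)[k [e [te [-> _]]]]; exists (fun=> 0) => //.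
by rewrite big1// => i _; rewrite scale0r.
Qed.

Lemma subbundleD B p u v : subbundle B -> B p u -> B p v -> B p (u + v).
Proof. by move=> sB Bu Bv; rewrite -[u]scale1r; exact: subbundle_lin. Qed.

Lemma subbundleZ B p (a : R) u : subbundle B -> B p u -> B p (a *: u).
Proof.
by move=> sB Bu; rewrite -[_ *: _]addr0; apply: subbundle_lin => //; exact: subbundle0.
Qed.

Lemma subbundleB B p u v : subbundle B -> B p u -> B p v -> B p (u - v).
Proof.
by move=> sB Bu Bv; apply: subbundleD => //; rewrite -scaleN1r; exact: subbundleZ.
Qed.

(** Makes the statements on subbundles available for fields without constraint, in particular for
    adjoints. Spanning and independence both follow by evaluating on the dual coordinates. *)
Lemma subbundle_tangent_bundle : subbundle (fun p : M => [set v | tangent p v]).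
Proof.
move=> p; have [e [y [se sy ey]]] := local_frame p.
exists m, e; split=> //; near=> q.
have [eE eY] : (forall v, tangent q v -> v = \sum_i v (y i) *: e i q) /\
     (forall i j, e i q (y j) = (i == j)%:R) by near: q.
split.
  apply/seteqP; split=> v /=.
    by move=> /eE ->; exists (fun i => v (y i)).
  by move=> [a _ <-]; apply: tangent_sum => i; apply: tangentZ; have [] := se i.
move=> a a0 i.
have E (l : seq 'I_m) : (\sum_(i <- l) a i *: e i q) (y i) = \sum_(j <- l) a j * (j == i)%:R.
  elim: l => [|j l IH]; first by rewrite !big_nil.
  by rewrite !big_cons -IH -eY.
have := E (index_enum _); rewrite a0 (bigD1 i)//= eqxx mulr1 big1 ?addr0.
  by move=> <-.
by move=> j /negPf ->; rewrite mulr0.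
Unshelve. all: by end_near. Qed.

(** The frame fields live on all of [M], so it is enough to freeze the coefficients of [v]. *)
Lemma vfield_extension p v : tangent p v -> exists2 Z, smooth_vfield Z & Z p = v.
Proof.
move=> tv; have [e [y [se sy ey]]] := local_frame p.
have [eE _] := nbhs_singleton ey.
exists (fun q => \sum_i v (y i) *: e i q); last by rewrite -eE.
apply: smooth_vfield_sum => i; apply: smooth_vfieldZ => // q.
exact: smooth_fun_at_cst.
Qed.

(** The smoothness test for fields defined pointwise by choice. Test fields are required to lie in
    [B] only near [p], because that is all the members of a local frame do. *)
Lemma subbundle_metric_smooth B U : subbundle B -> (forall q, B q (U q)) ->
  (forall Y, smooth_vfield Y -> forall p, (\forall q \near p, B q (Y q)) ->
     smooth_fun_at p (fun q => metric q (U q) (Y q))) ->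
  smooth_vfield U.
Proof.
move=> sB BU sU; split=> [p|f sf p]; first exact: (subbundle_tangent sB).
have [k [s [ss bs]]] := sB p.
have aP q : exists a : 'I_k -> R, is_basis (B q) (s ^~ q) -> U q = \sum_i a i *: s i q.
  have [[BE _]|nb] := pselect (is_basis (B q) (s ^~ q)); last by exists (fun=> 0).
  by have := BU q; rewrite BE => -[a _ <-]; exists a.
have [a aE] := choice aP.
apply: (@smooth_of_metric p k s a U f ss) => //.
  near=> q; have bq : is_basis (B q) (s ^~ q) by near: q.
  by split; [case: bq|exact: aE].
move=> j; apply: sU => //; near=> q.
have [-> _] : is_basis (B q) (s ^~ q) by near: q.
exists (fun i => (i == j)%:R) => //.
rewrite (bigD1 j)//= eqxx scale1r big1 ?addr0// => i /negPf ->.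
by rewrite scale0r.
Unshelve. all: by end_near. Qed.

End Gram.

(** * Orthogonal projections and the Koszul formula *)

Section OrthogonalProjection.
Context {R : realType} {m : nat} {M : riemannian R m}.
Implicit Types (p q : M) (u v w : functional M R) (X Y Z : vfield M R).
Variable E : M -> set (functional M R).
Hypothesis sE : subbundle E.

Lemma component_in_eq (A A' : set (functional M R)) u v : A u -> A' (v - u) ->
  (forall u', A u' -> A' (v - u') -> u' = u) -> component_in A A' v = u.
Proof.
move=> Au A'u uniq; rewrite /component_in; case: xgetP => [w _ [Aw A'w]|/(_ u)].
  exact: uniq.
by move=> H; exfalso; apply: H.
Qed.

Lemma perp_lin p (B : M -> set (functional M R)) (a : R) u v :
  (forall w, B p w -> tangent p w) ->
  perp B p u -> perp B p v -> perp B p (a *: u + v).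
Proof.
move=> tB [tu pu] [tv pv]; split; first exact: tangent_lin.
by move=> w Bw; rewrite metric_linl ?pu ?pv ?mulr0 ?addr0//; exact: tB.
Qed.

Lemma perpB p u v : perp E p u -> perp E p v -> perp E p (u - v).
Proof.
move=> pu pv; rewrite addrC -scaleN1r; apply: perp_lin => // w.
exact: subbundle_tangent.
Qed.

Lemma perpD p u v : perp E p u -> perp E p v -> perp E p (u + v).
Proof.
move=> pu pv; rewrite -[u]scale1r; apply: perp_lin => // w.
exact: subbundle_tangent.
Qed.

Lemma perp_metricr p u v : E p u -> perp E p v -> metric p u v = 0.
Proof. 
move=> Eu [tv pv]; rewrite metricC//; first exact: pv.
exact: subbundle_tangent Eu.
Qed.

Lemma perp_cap p u : E p u -> perp E p u -> u = 0.
Proof. by move=> Eu [tu pu]; apply: (metric_eq0 tu); exact: pu. Qed.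

Lemma orth_decomp p v : tangent p v -> exists u, E p u /\ perp E p (v - u).
Proof.
move=> tv; have [k [e [te [EE ie]]]] := subbundle_basis p sE.
have [a aE] := riesz (fun j => metric p v (e j)) te ie.
have tu : tangent p (\sum_i a i *: e i) by apply: tangent_sum => i; exact: tangentZ.
exists (\sum_i a i *: e i); split; first by rewrite EE; exists a.
split; first exact: tangentB.
rewrite EE => _ [b _ <-].
have tw : tangent p (\sum_i b i *: e i) by apply: tangent_sum => i; exact: tangentZ.
rewrite metricC//; last exact: tangentB.
rewrite metric_suml//; last exact: tangentB.
rewrite big1// => i _; rewrite metricC//; last exact: tangentB.
by rewrite metricBl// aE subrr mulr0.
Qed.

Definition orth_proj p v := component_in (E p) (perp E p) v.

Lemma orth_proj_eq p u v : E p u -> perp E p (v - u) -> orth_proj p v = u.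
Proof.
move=> Eu pu; apply: component_in_eq => // u' Eu' pu'.
apply/eqP; rewrite -subr_eq0; apply/eqP; apply: (@perp_cap p).
  exact: subbundleB.
have -> : u' - u = (v - u) - (v - u') by rewrite opprB [RHS]addrC addrA subrK.
exact: perpB.
Qed.

Lemma orth_proj_in p v : tangent p v -> E p (orth_proj p v).
Proof. by move=> /orth_decomp[u [Eu pu]]; rewrite (orth_proj_eq Eu pu). Qed.

Lemma orth_proj_perp p v : tangent p v -> perp E p (v - orth_proj p v).
Proof. by move=> /orth_decomp[u [Eu pu]]; rewrite (orth_proj_eq Eu pu). Qed.

Lemma component_perp p v : tangent p v ->
  component_in (perp E p) (E p) v = v - orth_proj p v.
Proof.
move=> tv; apply: component_in_eq; first exact: orth_proj_perp.
  by rewrite subKr; exact: orth_proj_in.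
move=> u' pu' Eu'; rewrite (orth_proj_eq Eu') ?subKr//.
Qed.

(** Against a field of [E], the projection of [Z] has the same inner product as [Z] itself. *)
Lemma orth_proj_smooth Z : smooth_vfield Z ->
  smooth_vfield (fun q => orth_proj q (Z q)).
Proof.
move=> sZ; have [tZ _] := sZ.
apply: (subbundle_metric_smooth sE) => [q|Y sY p EY]; first exact: orth_proj_in.
apply: smooth_fun_at_congr (metric_smooth (metricP M) sZ sY p).
near=> q; have EYq : E q (Y q) by near: q.
have [tY _] := sY; have [_ /(_ _ EYq)] := orth_proj_perp (tZ q).
rewrite metricBl//; first by move/eqP; rewrite subr_eq0 => /eqP.
exact/(subbundle_tangent sE)/orth_proj_in.
Unshelve. all: by end_near. Qed.

Lemma section_orth_proj Z : smooth_vfield Z ->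
  is_section E (fun q => orth_proj q (Z q)).
Proof.
move=> sZ; split; first exact: orth_proj_smooth.
by move=> p; apply: orth_proj_in; have [] := sZ.
Qed.

Lemma section_orth_perp Z : smooth_vfield Z ->
  is_section (perp E) (fun q => Z q - orth_proj q (Z q)).
Proof.
move=> sZ; split; first by apply: smooth_vfieldB => //; exact: orth_proj_smooth.
by move=> p; apply: orth_proj_perp; have [] := sZ.
Qed.

(** Connections act on fields, so a vector used as a test must first be extended; projecting an
    arbitrary extension leaves its value at [p] unchanged. *)
Lemma section_through p w : E p w -> exists2 U, is_section E U & U p = w.
Proof.
move=> Ew; have [Z sZ Zp] := vfield_extension (subbundle_tangent sE Ew).
exists (fun q => orth_proj q (Z q)); first exact: section_orth_proj.
rewrite Zp; apply: orth_proj_eq => //; rewrite subrr.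
by split=> [|u Eu]; [exact: tangent0|apply: metric0l; exact: subbundle_tangent Eu].
Qed.

Lemma perp_section_through p w : perp E p w ->
  exists2 U, is_section (perp E) U & U p = w.
Proof.
move=> pw; have [Z sZ Zp] := vfield_extension pw.1.
exists (fun q => Z q - orth_proj q (Z q)); first exact: section_orth_perp.
by rewrite Zp (@orth_proj_eq p 0) ?subr0//; exact: subbundle0.
Qed.

(** The double orthogonal complement is [E]: the normal part of [u] is orthogonal to itself. *)
Lemma in_subbundle_perp p u : tangent p u ->
  (forall w, perp E p w -> metric p u w = 0) -> E p u.
Proof.
move=> tu H; have Eu := orth_proj_in tu; have pu := orth_proj_perp tu.
suff -> : u = orth_proj p u by [].
apply/eqP; rewrite -subr_eq0; apply/eqP; apply: (metric_eq0 pu.1).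
rewrite metricBl ?H ?perp_metricr ?subrr//; [exact: subbundle_tangent Eu|exact: pu.1].
Qed.

Hypothesis gE : perp_totally_geodesic E.

Lemma nabla_perp_in V U p : is_section (perp E) V -> is_section (perp E) U ->
  perp E p (nabla p (V p) U).
Proof.
move=> sV sU; have tn : tangent p (nabla p (V p) U).
  apply: (connection_tangent (lc_connection (nablaP M))); [exact: sV.1.1|exact: sU.1].
by rewrite gE// /nabla_perp component_perp//; exact: orth_proj_perp.
Qed.

Lemma nabla_perp_preserves V W p : is_section (perp E) V -> is_section E W ->
  E p (nabla p (V p) W).
Proof.
move=> sV sW; have cM := lc_connection (nablaP M).
have tn : tangent p (nabla p (V p) W).
  by apply: (connection_tangent cM); [exact: sV.1.1|exact: sW.1].
apply: in_subbundle_perp => // w /perp_section_through[U sU <-].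
(* Differentiate the identically zero product of [W] and [U] along [V]; the term containing the
   derivative of [U] vanishes by [nabla_perp_in]. *)
have := lc_metric (nablaP M) (sV.1.1 p) sW.1 sU.1.
rewrite (_ : (fun q => _) = fun=> 0); last first.
  by apply/funext => q; apply: perp_metricr; [exact: sW.2|exact: sU.2].
rewrite (tangent_cst _ (sV.1.1 p)) => /esym.
by rewrite [X in _ + X]perp_metricr ?addr0//; [exact: sW.2|exact: nabla_perp_in].
Qed.

End OrthogonalProjection.

Section Koszul.
Context {R : realType} {m : nat} {M : riemannian R m}.
Implicit Types (p q : M) (X Y Z : vfield M R).

Lemma nabla_tangent Y p v : tangent p v -> smooth_vfield Y ->
  tangent p (nabla p v Y).
Proof. exact: (connection_tangent (lc_connection (nablaP M))). Qed.

Lemma lie_bracket_tangent X Y p : smooth_vfield X -> smooth_vfield Y ->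
  tangent p (lie_bracket X Y p).
Proof.
move=> sX sY; rewrite -(lc_torsion_free (nablaP M))//.
by apply: tangentB; apply: nabla_tangent => //; [exact: sX.1|exact: sY.1].
Qed.

Lemma koszul X Y Z p : smooth_vfield X -> smooth_vfield Y -> smooth_vfield Z ->
  2 * metric p (nabla p (X p) Y) (Z p) =
    X p (fun q => metric q (Y q) (Z q)) + Y p (fun q => metric q (X q) (Z q))
    - Z p (fun q => metric q (X q) (Y q))
    + metric p (lie_bracket X Y p) (Z p) - metric p (lie_bracket X Z p) (Y p)
    - metric p (lie_bracket Y Z p) (X p).
Proof.
move=> sX sY sZ; have lc := nablaP M.
have [tX _] := sX; have [tY _] := sY; have [tZ _] := sZ.
have tn U V : smooth_vfield U -> smooth_vfield V -> tangent p (nabla p (U p) V).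
  by move=> sU sV; apply: nabla_tangent => //; exact: sU.1.
rewrite (lc_metric lc (tX p) sY sZ) (lc_metric lc (tY p) sX sZ).
rewrite (lc_metric lc (tZ p) sX sY) -(lc_torsion_free lc sX sY).
rewrite -(lc_torsion_free lc sX sZ) -(lc_torsion_free lc sY sZ).
rewrite !metricBl//; try exact: tn.
rewrite [metric p (Y p) _]metricC//; last exact: tn.
rewrite [metric p (X p) (nabla p (Y p) Z)]metricC//; last exact: tn.
rewrite [metric p (X p) (nabla p (Z p) Y)]metricC//; last exact: tn.
ring.
Qed.

End Koszul.

(** * Riemannian maps and adjoints *)

Section SmoothMapTangent.
Context {R : realType} {m n : nat} {M : riemannian R m} {N : riemannian R n}.
Variable F : M -> N.
Hypothesis sF : smooth_map F.
Implicit Types (p q : M) (u v x z : functional M R) (w : functional N R).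

Lemma smooth_fun_at_pullback p (h : N -> R) :
  smooth_fun_at (F p) h -> smooth_fun_at p (h \o F).
Proof.
move=> sh; have [cF [c [c' [ac cp ac' cFp sFc]]]] := sF p.
have nF : \forall q \near p, chart_dom c' (F q) by exact: (cF _ (near_chart_dom ac' cFp)).
exists c; split=> //.
have sh' : smooth_at ((coord c' \o F \o param c) (coord c p)) (h \o param c' : 'rV[R]_n -> R^o).
  rewrite /= (chart_coordK (atlas_chart ac) cp); exact: smooth_fun_at_chart.
have := smooth_at_comp sFc sh'; apply: smooth_at_congr.
near=> y => /=; rewrite (chart_coordK (atlas_chart ac'))//.
by near: y; exact: (near_param ac cp nF).
Unshelve. all: by end_near. Qed.

Lemma smooth_fun_pullback (h : N -> R) : smooth_fun h -> smooth_fun (h \o F).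
Proof. by move=> sh p; exact/smooth_fun_at_pullback/sh. Qed.

Lemma tangent_map_lin (a : R) u v :
  tangent_map F (a *: u + v) = a *: tangent_map F u + tangent_map F v.
Proof.
apply/funext => f; rewrite /tangent_map [RHS]/GRing.add/= [(_ *: _) f]/GRing.scale/=.
by case: ifP => // _; rewrite scaler0 addr0.
Qed.

Lemma tangent_map0 : tangent_map F 0 = 0.
Proof. by apply/funext => f; rewrite /tangent_map; case: ifP. Qed.

Lemma tangent_mapB u v : tangent_map F (u - v) = tangent_map F u - tangent_map F v.
Proof. by rewrite addrC -scaleN1r tangent_map_lin scaleN1r addrC. Qed.

Lemma tangent_map_sum (T : Type) (s : seq T) (a : T -> R) (e : T -> functional M R) :
  tangent_map F (\sum_(i <- s) a i *: e i) = \sum_(i <- s) a i *: tangent_map F (e i).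
Proof.
elim: s => [|i s IH]; first by rewrite !big_nil tangent_map0.
by rewrite !big_cons tangent_map_lin IH.
Qed.

Lemma tangent_mapE v (f : N -> R) : smooth_fun f -> tangent_map F v f = v (f \o F).
Proof. by move=> sf; rewrite /tangent_map asboolT. Qed.

Lemma tangent_map_tangent p v : tangent p v -> tangent (F p) (tangent_map F v).
Proof.
move=> tv; have [cF [c [c' [ac cp ac' cFp sFc]]]] := sF p.
have nF : \forall q \near p, chart_dom c' (F q) by exact: (cF _ (near_chart_dom ac' cFp)).
have [h ->] := tangent_coord ac cp tv.
suff -> : tangent_map F (coord_vector c p h) = coord_vector c' (F p)
    ('D_h (coord c' \o F \o param c) (coord c p)) by exact: coord_vector_tangent.
apply/funext => f; rewrite /tangent_map /coord_vector; case: asboolP => // sf.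
rewrite asboolT; last exact: smooth_fun_pullback.
have dt := smooth_at_differentiable sFc.
have E : coord c' (F p) = (coord c' \o F \o param c) (coord c p).
  by rewrite /= (chart_coordK (atlas_chart ac) cp).
have df : differentiable (f \o param c' : 'rV[R]_n -> R^o)
    ((coord c' \o F \o param c) (coord c p)).
  by rewrite -E; exact: smooth_at_differentiable (smooth_fun_at_chart ac' cFp (sf _)).
rewrite E [RHS](deriveE _ df) (deriveE _ dt).
have /= <- := congr1 (@^~ h) (diff_comp dt df).
rewrite -deriveE; last exact: differentiable_comp.
apply: near_eq_derive; near=> y => /=; rewrite (chart_coordK (atlas_chart ac'))//.
by near: y; exact: (near_param ac cp nF).
Unshelve. all: by end_near. Qed.

(** The default of [xget] is excluded by exhibiting an adjoint: the vector with the required inner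
    products against a basis of the tangent space. *)
Lemma adjoint_mapP p w : tangent (F p) w -> tangent p (adjoint_map F p w) /\
  forall x, tangent p x ->
    metric p x (adjoint_map F p w) = metric (F p) (tangent_map F x) w.
Proof.
move=> tw; rewrite /adjoint_map; case: xgetP => [u _ //|].
have [k [e [te [eE ie]]]] := subbundle_basis p (@subbundle_tangent_bundle _ _ M).
have [a aE] := riesz (fun j => metric (F p) (tangent_map F (e j)) w) te ie.
have tu : tangent p (\sum_i a i *: e i) by apply: tangent_sum => i; exact: tangentZ.
move=> /(_ (\sum_i a i *: e i)) H; exfalso; apply: H; split=> // x tx.
have : [set v | tangent p v] x by [].
rewrite eE => -[b _ <-]; rewrite metric_suml// tangent_map_sum metric_suml//; last first.
  by move=> i; exact: tangent_map_tangent.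
by apply: eq_bigr => i _; rewrite metricC// aE.
Qed.

Lemma adjoint_map_tangent p w : tangent (F p) w -> tangent p (adjoint_map F p w).
Proof. by case/adjoint_mapP. Qed.

Lemma adjoint_mapE p w x : tangent (F p) w -> tangent p x ->
  metric p x (adjoint_map F p w) = metric (F p) (tangent_map F x) w.
Proof. by move=> /adjoint_mapP[_]; apply. Qed.

Lemma adjoint_map_perp_ker p w : tangent (F p) w ->
  perp (ker_tangent_map F) p (adjoint_map F p w).
Proof.
move=> tw; have ta := adjoint_map_tangent tw; split=> // x [tx Fx].
by rewrite metricC// adjoint_mapE// Fx metric0l.
Qed.

(** Testing against [Y] gives the product of F_* Y with [W]. As F_* Y is only a field along [F], it
    is expanded in a frame of [N] near [F p], with coefficients [Y q (y i \o F)]. *)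
Lemma adjoint_map_smooth (W : vfield N R) : smooth_vfield W ->
  smooth_vfield (fun q => adjoint_map F q (W (F q))).
Proof.
move=> sW; have [tW _] := sW.
apply: (subbundle_metric_smooth (@subbundle_tangent_bundle _ _ M)) => [q|Y [tY sY] p _].
  exact: adjoint_map_tangent.
have [e [y [se sy ey]]] := local_frame (F p).
pose g (q : M) : R :=
  \sum_i (Y q (y i \o F) : R) * ((fun r : N => metric r (e i r) (W r)) \o F) q.
apply: (@smooth_fun_at_congr _ _ _ p g); last first.
  apply: smooth_fun_at_sum => i _; apply: smooth_fun_atM.
    exact: (sY _ (smooth_fun_pullback (sy i))).
  exact: (smooth_fun_pullback (metric_smooth (metricP N) (se i) sW)).
have [cF _] := sF p.
have ey' := cF _ ey.
near=> q.
have [H _] : (forall v : functional N R, tangent (F q) v -> v = \sum_i v (y i) *: e i (F q)) /\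
     (forall i j, e i (F q) (y j) = (i == j)%:R) by near: q; exact: ey'.
rewrite metricC//; last exact: adjoint_map_tangent.
rewrite adjoint_mapE// (H _ (tangent_map_tangent (tY q))) metric_suml//; last first.
  by move=> i; have [] := se i.
by apply: eq_bigr => i _; rewrite tangent_mapE.
Unshelve. all: by end_near. Qed.

End SmoothMapTangent.

(** * Horizontal lifts and normality of the second fundamental form *)

Section RiemannianMapTheory.
Context {R : realType} {m n : nat} {M : riemannian R m} {N : riemannian R n}.
Variables (F : M -> N) (E : N -> set (functional N R)).
Hypotheses (sF : smooth_map F) (rF : riemannian_map F) (hE : range_distribution F E).
Implicit Types (p q : M) (u v x z : functional M R) (w : functional N R).

Let sE : subbundle E := hE.1.

Lemma range_tangent p w : E (F p) w -> tangent (F p) w.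
Proof. exact: subbundle_tangent. Qed.

(* The lift is the projection of x to the span of the adjoints of a basis of the
   range; no basis of the kernel is needed. *)
Lemma perp_ker_lift p x : tangent p x ->
  exists2 z, perp (ker_tangent_map F) p z & tangent_map F z = tangent_map F x.
Proof.
move=> tx; have [k [e [te [eE ie]]]] := subbundle_basis (F p) sE.
have Ee i : E (F p) (e i).
  rewrite eE; exists (fun j => (j == i)%:R) => //.
  rewrite (bigD1 i)//= eqxx scale1r big1 ?addr0// => j /negPf ->.
  by rewrite scale0r.
pose u i := adjoint_map F p (e i).
have tu i : tangent p (u i) by exact: adjoint_map_tangent.
(* The combination [w] lies in the range, say w = F_* y, so its square norm is the product of [y]
   with the vanishing combination of adjoints. *)
have iu : independent u.
  move=> a a0; apply: ie; set w := \sum_i _.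
  have : E (F p) w by rewrite eE; exists a.
  rewrite hE.2 => -[y ty yw].
  apply: (metric_eq0 (p := F p)); first by rewrite -yw; exact: tangent_map_tangent.
  rewrite {1}/w metric_suml//; last by rewrite -yw; exact: tangent_map_tangent.
  transitivity (metric p (\sum_i a i *: u i) y); last by rewrite a0 metric0l.
  rewrite [RHS]metric_suml//; apply: eq_bigr => i _; congr (_ * _).
  by rewrite [RHS]metricC// adjoint_mapE// yw metricC// -yw; exact: tangent_map_tangent.
have [a aE] := riesz (fun j => metric p x (u j)) tu iu.
set z := \sum_i a i *: u i in aE.
have pz : perp (ker_tangent_map F) p z.
  split; first by apply: tangent_sum => i; exact: tangentZ.
  move=> y [ty Fy]; rewrite metric_suml// big1// => i _.
  by rewrite (adjoint_map_perp_ker sF (te i)).2 ?mulr0.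
exists z => //; apply/eqP; rewrite eq_sym -subr_eq0 -tangent_mapB; apply/eqP.
have [tz _] := pz.
have txz : tangent p (x - z) by exact: tangentB.
have tFxz := tangent_map_tangent sF txz.
(* The image of [x - z] is in the range, and it is orthogonal to each [e i] because [x - z] is
   orthogonal to the adjoint [u i]. *)
apply: (metric_eq0 tFxz).
have : E (F p) (tangent_map F (x - z)) by rewrite hE.2; exists (x - z).
rewrite eE => -[b _ bE]; rewrite -{1}bE metric_suml// big1// => i _.
by rewrite metricC// -adjoint_mapE// -/(u i) metricBl// aE subrr mulr0.
Qed.

(** Replacing [x] by a horizontal vector with the same image changes it by an element of the kernel,
    to which [z] is orthogonal. Brackets of horizontal fields take the place of [x] in the Koszul
    formula. *)
Lemma metric_tangent_map p x z : tangent p x -> perp (ker_tangent_map F) p z ->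
  metric (F p) (tangent_map F x) (tangent_map F z) = metric p x z.
Proof.
move=> tx pz; have [y py yE] := perp_ker_lift tx.
have [tz kz] := pz; have [ty _] := py.
rewrite -yE rF//; apply/eqP; rewrite -subr_eq0 -metricBl//; apply/eqP.
rewrite metricC//; last exact: tangentB.
by apply: kz; split; [exact: tangentB|rewrite tangent_mapB yE subrr].
Qed.

(** The adjoint is horizontal, so its image and [w] have the same product with every F_* x; their
    difference is itself of this form. *)
Lemma tangent_map_adjoint p w : E (F p) w -> tangent_map F (adjoint_map F p w) = w.
Proof.
move=> Ew; have tw := range_tangent Ew.
have pa := adjoint_map_perp_ker sF tw; have [ta _] := pa.
have tFa := tangent_map_tangent sF ta.
apply/eqP; rewrite -subr_eq0; apply/eqP.
have td : tangent (F p) (tangent_map F (adjoint_map F p w) - w) by exact: tangentB.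
apply: (metric_eq0 td).
have : E (F p) (tangent_map F (adjoint_map F p w) - w).
  by apply: subbundleB => //; rewrite hE.2; exists (adjoint_map F p w).
rewrite {1}hE.2 => -[x tx xE]; rewrite -{1}xE metricBr//; last exact: tangent_map_tangent.
by rewrite metric_tangent_map// adjoint_mapE// subrr.
Qed.

Lemma lie_bracket_related (X Y : vfield M R) (X' Y' : vfield N R) p :
  smooth_vfield X -> smooth_vfield Y -> smooth_vfield X' -> smooth_vfield Y' ->
  (forall q, tangent_map F (X q) = X' (F q)) ->
  (forall q, tangent_map F (Y q) = Y' (F q)) ->
  tangent_map F (lie_bracket X Y p) = lie_bracket X' Y' (F p).
Proof.
move=> sX sY sX' sY' XX YY; apply/funext => f.
rewrite /tangent_map /lie_bracket; case: asboolP => // sf.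
rewrite asboolT; last exact: smooth_fun_pullback.
have EY : (fun q => Y q (f \o F)) = (fun y => Y' y f) \o F.
  by apply/funext => q /=; rewrite -YY tangent_mapE.
have EX : (fun q => X q (f \o F)) = (fun y => X' y f) \o F.
  by apply/funext => q /=; rewrite -XX tangent_mapE.
rewrite EX EY -XX -YY !tangent_mapE//; [exact: sX'.2|exact: sY'.2].
Qed.

(* The Koszul formula determines both Levi-Civita connections, and F preserves
   each of its terms on related horizontal fields. *)
Lemma nabla_related (X Y Z : vfield M R) (X' Y' Z' : vfield N R) p :
  is_section (perp (ker_tangent_map F)) X -> is_section (perp (ker_tangent_map F)) Y ->
  is_section (perp (ker_tangent_map F)) Z ->
  smooth_vfield X' -> smooth_vfield Y' -> smooth_vfield Z' ->
  (forall q, tangent_map F (X q) = X' (F q)) ->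
  (forall q, tangent_map F (Y q) = Y' (F q)) ->
  (forall q, tangent_map F (Z q) = Z' (F q)) ->
  metric p (nabla p (X p) Y) (Z p) =
    metric (F p) (nabla (F p) (X' (F p)) Y') (Z' (F p)).
Proof.
move=> [sX pX] [sY pY] [sZ pZ] sX' sY' sZ' XX YY ZZ.
have metricE (U V : vfield M R) (U' V' : vfield N R) :
    (forall q, perp (ker_tangent_map F) q (U q)) ->
    (forall q, perp (ker_tangent_map F) q (V q)) ->
    (forall q, tangent_map F (U q) = U' (F q)) ->
    (forall q, tangent_map F (V q) = V' (F q)) ->
    (fun q => metric q (U q) (V q)) = (fun y => metric y (U' y) (V' y)) \o F.
  by move=> pU pV UU VV; apply/funext => q /=; rewrite -UU -VV rF.
have derivE (U V W : vfield M R) (U' V' W' : vfield N R) :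
    smooth_vfield V' -> smooth_vfield W' ->
    (forall q, perp (ker_tangent_map F) q (V q)) ->
    (forall q, perp (ker_tangent_map F) q (W q)) ->
    (forall q, tangent_map F (U q) = U' (F q)) ->
    (forall q, tangent_map F (V q) = V' (F q)) ->
    (forall q, tangent_map F (W q) = W' (F q)) ->
    U p (fun q => metric q (V q) (W q)) = U' (F p) (fun y => metric y (V' y) (W' y)).
  move=> sV' sW' pV pW UU VV WW; rewrite (metricE _ _ _ _ pV pW VV WW).
  by rewrite -tangent_mapE ?UU//; exact: (metric_smooth (metricP N) sV' sW').
have bracketE (U V W : vfield M R) (U' V' W' : vfield N R) :
    smooth_vfield U -> smooth_vfield V -> smooth_vfield U' -> smooth_vfield V' ->
    (forall q, perp (ker_tangent_map F) q (W q)) ->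
    (forall q, tangent_map F (U q) = U' (F q)) ->
    (forall q, tangent_map F (V q) = V' (F q)) ->
    (forall q, tangent_map F (W q) = W' (F q)) ->
    metric p (lie_bracket U V p) (W p) =
    metric (F p) (lie_bracket U' V' (F p)) (W' (F p)).
  move=> sU sV sU' sV' pW UU VV WW.
  rewrite -(lie_bracket_related p sU sV sU' sV' UU VV) -WW metric_tangent_map//.
  exact: lie_bracket_tangent.
have two0 : (2 : R) != 0 by rewrite pnatr_eq0.
apply: (mulfI two0); rewrite koszul// (koszul (F p) sX' sY' sZ').
rewrite (derivE X Y Z X' Y' Z')// (derivE Y X Z Y' X' Z')// (derivE Z X Y Z' X' Y')//.
rewrite (bracketE X Y Z X' Y' Z')// (bracketE X Z Y X' Z' Y')//.
by rewrite (bracketE Y Z X Y' Z' X').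
Qed.

Lemma section_adjoint W : is_section E W ->
  is_section (perp (ker_tangent_map F)) (fun q => adjoint_map F q (W (F q))) /\
  forall q, tangent_map F (adjoint_map F q (W (F q))) = W (F q).
Proof.
move=> [sW EW]; split; last by move=> q; exact: tangent_map_adjoint.
split; first exact: adjoint_map_smooth.
by move=> q; apply: adjoint_map_perp_ker => //; exact: sW.1.
Qed.

(** A test vector in [E] is extended to a section and lifted by the adjoint; moving F_* across the
    product by adjunction reduces the claim to [nabla_related]. *)
Lemma nabla_sub_perp (X : vfield M R) (X' W : vfield N R) p :
  is_section (perp (ker_tangent_map F)) X -> is_section E X' -> is_section E W ->
  (forall q, tangent_map F (X q) = X' (F q)) ->
  perp E (F p) (nabla (F p) (X' (F p)) W -
    tangent_map F (nabla p (X p) (fun q => adjoint_map F q (W (F q))))).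
Proof.
move=> hX hX' hW XX; have [hY YY] := section_adjoint hW.
have tn : tangent p (nabla p (X p) (fun q => adjoint_map F q (W (F q)))).
  by apply: nabla_tangent; [exact: hX.1.1|exact: hY.1].
have tn' : tangent (F p) (nabla (F p) (X' (F p)) W).
  by apply: nabla_tangent; [exact: hX'.1.1|exact: hW.1].
have tFn := tangent_map_tangent sF tn.
split; first exact: tangentB.
move=> w /(section_through sE)[Z' hZ' <-].
have [hZ ZZ] := section_adjoint hZ'.
rewrite metricBl//; last exact: hZ'.1.1.
rewrite -(nabla_related p hX hY hZ hX'.1 hW.1 hZ'.1 XX YY ZZ) adjoint_mapE ?subrr//.
exact: hZ'.1.1.
Qed.

End RiemannianMapTheory.

(** * Covariant derivatives along a curve *)

Section Curves.
Context {R : realType} {n : nat}.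

Lemma smooth_fun_curve (M : manifold R n) (I : set R) (gamma : R -> M) (f : M -> R) t :
  smooth_curve I gamma -> I t -> smooth_fun f ->
  smooth_at (t : R^o) (f \o gamma : R^o -> R^o).
Proof.
move=> sg It sf; have [cg [c [ac cp sc]]] := sg t It.
have := smooth_at_comp sc (smooth_fun_at_chart ac cp (sf _)).
have nc := cg _ (near_chart_dom ac cp).
apply: smooth_at_congr; near=> s => /=; rewrite (chart_coordK (atlas_chart ac))//.
by near: s; exact: nc.
Unshelve. all: by end_near. Qed.

Context {N : riemannian R n} {I : set R} {gamma : R -> N}.
Hypothesis oI : open I.
(** Smoothness of the curve is expressed through functions: in this form it passes from a curve on
    [M] to its image under [F] by pulling functions back, with no chart along the image. *)
Hypothesis sgamma : forall (f : N -> R) t, smooth_fun f -> I t ->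
  smooth_at (t : R^o) (f \o gamma : R^o -> R^o).

Lemma field_along_curve_restrict (Z : vfield N R) : smooth_vfield Z ->
  field_along_curve I gamma (fun s => Z (gamma s)).
Proof.
move=> [tZ sZ]; split=> [t _|f sf]; first exact: tZ.
by apply/smooth_onP => // t It; exact: (sgamma (sZ _ sf) It).
Qed.

Lemma smooth_velocity (f : N -> R) : smooth_fun f ->
  smooth_on (I : set R^o) (fun t : R^o => velocity gamma t f : R^o).
Proof.
move=> sf; apply/smooth_onP => // t It.
have := smooth_at_derive (1 : R^o) (sgamma sf It).
apply: smooth_at_congr; near=> s.
by rewrite /velocity asboolT// derive1E.
Unshelve. all: by end_near. Qed.

(* Fields agreeing near t differ by (s - t)^2 times a smooth field, so no bump
   function is needed. *)
Lemma covariant_derivative_local D (W W' : R -> functional N R) t :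
  is_covariant_derivative I gamma D ->
  field_along_curve I gamma W -> field_along_curve I gamma W' ->
  I t -> (\forall s \near t, W s = W' s) -> D W t = D W' t.
Proof.
move=> cD [tW sW] [tW' sW'] It WW'.
pose a (s : R) : R := (s - t) * (s - t).
pose Y s : functional N R := (a s)^-1 *: (W s - W' s).
have a0 s : s != t -> a s != 0 by move=> st; rewrite mulf_neq0// subr_eq0.
have Yt : Y t = 0 by rewrite /Y (nbhs_singleton WW') subrr scaler0.
have WE : W = fun s => W' s + a s *: Y s.
  apply/funext => s; have [->|st] := eqVneq s t.
    by rewrite Yt scaler0 addr0 (nbhs_singleton WW').
  by rewrite /Y scalerA divff ?a0// scale1r addrC subrK.
have sa s : smooth_at (s : R^o) (a : R^o -> R^o).
  by apply: smooth_atM; (apply: smooth_atD; [exact: smooth_at_id|exact: smooth_at_cst]).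
have sona : smooth_on (I : set R^o) (a : R^o -> R^o) by apply/smooth_onP.
have fY : field_along_curve I gamma Y.
  split=> [s Is|f sf].
    by apply: tangentZ; apply: tangentB; [exact: tW|exact: tW'].
  apply/smooth_onP => // s Is; have [->|st] := eqVneq s t.
    apply: smooth_at_congr (smooth_at_cst _ (0 : R^o)); near=> r.
    have WW'r : W r = W' r by near: r.
    by rewrite /Y WW'r subrr scaler0.
  apply: (@smooth_atM _ _ (fun s : R^o => (a s)^-1 : R^o) (fun s => W s f - W' s f)).
    by apply: smooth_atV; [exact: sa|exact: a0].
  have sWf := (smooth_onP _ oI).1 (sW f sf) s Is.
  have sWf' := (smooth_onP _ oI).1 (sW' f sf) s Is.
  apply: smooth_atD => //.
  have := smooth_atM (smooth_at_cst (s : R^o) (-1 : R^o)) sWf'.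
  by apply: smooth_at_congr; near=> r; rewrite mulN1r.
have faY : field_along_curve I gamma (fun s => a s *: Y s).
  split=> [s Is|f sf]; first by apply: tangentZ; exact: fY.1.
  apply/smooth_onP => // s Is; apply: smooth_atM; first exact: sa.
  exact: (smooth_onP _ oI).1 (fY.2 f sf) s Is.
(* Both Leibniz terms vanish, one because [Y t] is 0 and the other because [a t] is 0. *)
rewrite WE (cd_add cD)// (cd_leibniz cD)// Yt scaler0 add0r.
by rewrite /a subrr mul0r scale0r addr0.
Unshelve. all: by end_near. Qed.

Lemma covariant_derivative_velocity D (Z : vfield N R) t :
  is_covariant_derivative I gamma D -> smooth_vfield Z -> I t ->
  (forall s, I s -> tangent (gamma s) (velocity gamma s)) ->
  (\forall s \near t, velocity gamma s = Z (gamma s)) ->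
  D (velocity gamma) t = nabla (gamma t) (Z (gamma t)) Z.
Proof.
move=> cD sZ It tv vZ.
have -> : D (velocity gamma) t = D (fun s => Z (gamma s)) t.
  apply: covariant_derivative_local => //; last exact: field_along_curve_restrict.
  by split=> // f; exact: smooth_velocity.
by rewrite (cd_restrict cD)// (nbhs_singleton vZ).
Qed.

End Curves.

(** * The Kähler structure and the operators phi, omega, B, C *)

Section Kahler.
Context {R : realType} {n : nat} {N : riemannian R n}.
Variable P : N -> functional N R -> functional N R.
Hypothesis kP : is_kahler P.
Implicit Types (p : N) (u v w : functional N R).

Lemma kahler0 p : P p 0 = 0.
Proof.
have := kahler_linear kP (-1) (tangent0 p) (tangent0 p).
by rewrite scaler0 addr0 scaleN1r addNr.
Qed.

Lemma kahlerD p u v : tangent p u -> tangent p v -> P p (u + v) = P p u + P p v.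
Proof. by move=> tu tv; have := kahler_linear kP 1 tu tv; rewrite !scale1r. Qed.

Lemma kahler_eq0 p v : tangent p v -> P p v = 0 <-> v = 0.
Proof.
move=> tv; split=> [Pv|->]; last exact: kahler0.
by have := kahler_sqr kP tv; rewrite Pv kahler0 => /esym/eqP; rewrite oppr_eq0 => /eqP.
Qed.

Variables E D1 D2 : N -> set (functional N R).
Hypotheses (sE : subbundle E) (sP : semi_invariant P E D1 D2).

Lemma D1_sub p u : D1 p u -> E p u.
Proof.
move=> Du; rewrite (si_sum sP); exists u => //; exists 0; rewrite ?addr0//.
exact: subbundle0 (si_D2 sP).
Qed.

Lemma D2_sub p u : D2 p u -> E p u.
Proof.
move=> Du; rewrite (si_sum sP); exists 0; first exact: subbundle0 (si_D1 sP).
by exists u; rewrite ?add0r.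
Qed.

Lemma PD2_perp p u : PD2 P D2 p u -> perp E p u.
Proof. exact: si_P_D2 sP _ _. Qed.

(** [P] maps [D1] into [E] and [D2] into the complement of [E], so splitting [P p w] along [D1] and
    [P D2] is its tangential and normal splitting; uniqueness is inherited from the latter. *)
Lemma phi_omega_opE p w : E p w ->
  phi_op P D1 D2 p w = orth_proj E p (P p w) /\
  omega_op P D1 D2 p w = P p w - orth_proj E p (P p w).
Proof.
move=> Ew; have := Ew; rewrite (si_sum sP) => -[d1 Dd1 [d2 Dd2 dE]].
have td1 := subbundle_tangent (si_D1 sP) Dd1.
have td2 := subbundle_tangent (si_D2 sP) Dd2.
have PwE : P p w = P p d1 + P p d2 by rewrite -dE kahlerD.
have DPd1 : D1 p (P p d1) by rewrite -(si_P_D1 sP); exists d1.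
have DPd2 : PD2 P D2 p (P p d2) by exists d2.
have oE u : D1 p u -> PD2 P D2 p (P p w - u) -> orth_proj E p (P p w) = u.
  by move=> Du PDu; apply: orth_proj_eq => //; [exact: D1_sub|exact: PD2_perp].
have E2 : P p w - P p d1 = P p d2 by rewrite PwE addrC addKr.
have oPw : orth_proj E p (P p w) = P p d1 by apply: oE => //; rewrite E2.
have PDw : PD2 P D2 p (P p w - P p d1) by rewrite E2.
have D1w : D1 p (P p w - P p d2) by rewrite -E2 subKr.
split; first by rewrite oPw; apply: (component_in_eq DPd1 PDw) => u Du /(oE _ Du) <-.
rewrite oPw E2; apply: (component_in_eq DPd2 D1w) => u Du D1u.
have PDu : PD2 P D2 p (P p w - (P p w - u)) by rewrite subKr.
by rewrite -E2 -oPw (oE _ D1u PDu) subKr.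
Qed.

(** For [d2] in [D2], the product of [P p v] with [P p d2] equals that of [v] with [d2], which is 0.
    Hence [Cpart] is the whole normal part of [P p v]. *)
Lemma eta_perp p v : perp E p v -> eta_bundle P E D2 p (P p v - orth_proj E p (P p v)).
Proof.
move=> pv; have tPv := kahler_tangent kP pv.1.
have po := orth_proj_perp sE tPv; split=> //; split; first exact: po.1.
move=> _ [d2 Dd2 <-]; have Ed2 := D2_sub Dd2.
have td2 := subbundle_tangent sE Ed2.
have tPd2 := kahler_tangent kP td2.
have Eo := orth_proj_in sE tPv.
rewrite metricBl//; last exact: subbundle_tangent Eo.
rewrite (kahler_isometry kP pv.1 td2) pv.2// (perp_metricr sE Eo) ?subrr//.
by apply: PD2_perp; exists d2.
Qed.

Lemma B_C_partE p v : perp E p v ->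
  Bpart P E D2 p v = orth_proj E p (P p v) /\
  Cpart P E D2 p v = P p v - orth_proj E p (P p v).
Proof.
move=> pv; have tPv := kahler_tangent kP pv.1.
have ee := eta_perp pv; have Eo := orth_proj_in sE tPv; split.
  by apply: component_in_eq => // u Eu [pu _]; rewrite (orth_proj_eq sE Eu pu).
apply: component_in_eq => //; first by rewrite subKr.
move=> u [pu _] Eu; rewrite (orth_proj_eq sE Eu) subKr//.
Qed.

End Kahler.

(** * The acceleration of the image curve *)

Section Acceleration.
Context {R : realType} {m n : nat} {M : riemannian R m} {N : riemannian R n}.
Variables (P : N -> functional N R -> functional N R) (F : M -> N).
Variables (E D1 D2 : N -> set (functional N R)).
Variable DF : M -> functional M R -> (M -> functional N R) -> functional N R.
Hypotheses (kP : is_kahler P) (sF : smooth_map F) (rF : riemannian_map F).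
Hypotheses (hE : range_distribution F E) (sP : semi_invariant P E D1 D2).
Hypotheses (gE : perp_totally_geodesic E) (cDF : is_pullback_connection F DF).
Variables (X : vfield M R) (X' V : vfield N R) (p : M).
Hypotheses (hX : is_section (perp (ker_tangent_map F)) X) (hX' : is_section E X').
Hypotheses (XX : forall q, X' (F q) = tangent_map F (X q)) (hV : is_section (perp E) V).

Let sE : subbundle E := hE.1.

(** The letters f, o, B, c name the four parts of the image under [P], and a final x or v the
    direction of differentiation. The tangential corrections [o], [tB], [c], [tf] occur once with
    each sign. *)
Lemma sum_regroup (T : zmodType) (o tB c fv Bv tf fx ox Bx cx ov cv : T) :
  o + tB + c + fv + Bv + tf +
    ((fx - tf) + (ox - o) + (Bx - tB) + (cx - c) + ov + cv) =
  (fx + fv) + (ox + ov) + ((Bx + Bv) + (cx + cv)).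
Proof.
have -> : o + tB + c + fv + Bv + tf = (tf + o + tB + c) + (fv + Bv).
  by rewrite (ACl ((6 * 1 * 2 * 3) * (4 * 5))).
have -> : (fx - tf) + (ox - o) + (Bx - tB) + (cx - c) + ov + cv =
    (fx + ox + Bx + cx) + (ov + cv) - (tf + o + tB + c).
  by rewrite !opprD (AC (2 * 2 * 2 * 2 * 1 * 1) ((1 * 3 * 5 * 7) * (9 * 10) * (2 * 4 * 6 * 8))).
rewrite addrC addrA subrK.
by rewrite (AC (4 * 2 * 2) ((1 * 7) * (2 * 5) * ((3 * 8) * (4 * 6)))).
Qed.

Lemma acceleration_eq0 :
  let y := F p in
  let phiX := fun q => phi_op P D1 D2 q (X' q) in
  let omegaX := fun q => omega_op P D1 D2 q (X' q) in
  let BV := fun q => Bpart P E D2 q (V q) in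
  let CV := fun q => Cpart P E D2 q (V q) in
  let adj_phiX := fun q : M => adjoint_map F q (phiX (F q)) in
  let adj_BV := fun q : M => adjoint_map F q (BV (F q)) in
  nabla y (X' y + V y) (fun q => X' q + V q) = 0 <->
  - shape_op E y omegaX (X' y) + tangent_map F (nabla p (X p) adj_BV)
    - shape_op E y CV (X' y) + nabla y (V y) phiX + nabla y (V y) BV
    + tangent_map F (nabla p (X p) adj_phiX) = 0
  /\
  second_fundamental_form F DF p (X p) adj_phiX + nabla_perp E y (X' y) omegaX
    + second_fundamental_form F DF p (X p) adj_BV + nabla_perp E y (X' y) CV
    + nabla_perp E y (V y) omegaX + nabla_perp E y (V y) CV = 0.
Proof.
move=> y phiX omegaX BV CV adj_phiX adj_BV.
have cN := lc_connection (nablaP N).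
have sPX := kahler_smooth kP hX'.1; have sPV := kahler_smooth kP hV.1.
have phiXE : phiX = fun q => orth_proj E q (P q (X' q)).
  by apply/funext => q; have [] := phi_omega_opE kP sE sP (hX'.2 q).
have omegaXE : omegaX = fun q => P q (X' q) - orth_proj E q (P q (X' q)).
  by apply/funext => q; have [] := phi_omega_opE kP sE sP (hX'.2 q).
have BVE : BV = fun q => orth_proj E q (P q (V q)).
  by apply/funext => q; have [] := B_C_partE kP sE sP (hV.2 q).
have CVE : CV = fun q => P q (V q) - orth_proj E q (P q (V q)).
  by apply/funext => q; have [] := B_C_partE kP sE sP (hV.2 q).
have hphi : is_section E phiX by rewrite phiXE; exact: section_orth_proj.
have hB : is_section E BV by rewrite BVE; exact: section_orth_proj.
have homega : is_section (perp E) omegaX by rewrite omegaXE; exact: section_orth_perp.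
have hC : is_section (perp E) CV by rewrite CVE; exact: section_orth_perp.
have tx : tangent y (X' y) by exact: hX'.1.1.
have tv : tangent y (V y) by exact: hV.1.1.
have txv : tangent y (X' y + V y) by exact: tangentD.
have sZ := smooth_vfieldD hX'.1 hV.1.
have PZ : (fun q => P q (X' q + V q)) =
    fun q => (phiX q + omegaX q) + (BV q + CV q).
  apply/funext => q; rewrite phiXE omegaXE BVE CVE.
  rewrite (kahlerD kP (hX'.1.1 q) (hV.1.1 q)).
  by congr (_ + _); rewrite addrC subrK.
have nD W : smooth_vfield W ->
    nabla y (X' y + V y) W = nabla y (X' y) W + nabla y (V y) W.
  by move=> sW; have := connection_linear cN 1 tx tv sW; rewrite !scale1r.
rewrite -(kahler_eq0 kP (nabla_tangent txv sZ)) -(kahler_parallel kP txv sZ) PZ.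
rewrite (connection_add cN txv (smooth_vfieldD hphi.1 homega.1) (smooth_vfieldD hB.1 hC.1)).
rewrite (connection_add cN txv hphi.1 homega.1) (connection_add cN txv hB.1 hC.1).
rewrite !nD; [|exact: hC.1|exact: hB.1|exact: homega.1|exact: hphi.1].
have shapeE W : - shape_op E y W (X' y) = orth_proj E y (nabla y (X' y) W).
  by rewrite /shape_op opprK.
have perpE W : smooth_vfield W ->
    nabla_perp E y (X' y) W = nabla y (X' y) W - orth_proj E y (nabla y (X' y) W).
  by move=> sW; rewrite /nabla_perp component_perp//; exact: nabla_tangent.
have sffE W : is_section E W ->
    second_fundamental_form F DF p (X p) (fun q => adjoint_map F q (W (F q))) =
    nabla y (X' y) W - tangent_map F (nabla p (X p) (fun q => adjoint_map F q (W (F q)))).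
  move=> hW; rewrite /second_fundamental_form; congr (_ - _).
  (* F_* undoes the adjoint on the range, so [DF] differentiates a restriction of a field on [N] and
     [pc_restrict] applies. *)
  rewrite (_ : (fun q => _) = fun q => W (F q)); last first.
    by apply/funext => q; exact: (section_adjoint sF rF hE hW).2.
  by rewrite (pc_restrict cDF (hX.1.1 p) hW.1) -XX.
rewrite !shapeE (sffE _ hphi) (sffE _ hB) (perpE _ homega.1) (perpE _ hC.1).
(* Normal derivatives along [V] become full derivatives, the form in which the eight terms add
   up. *)
rewrite -(gE hV homega) -(gE hV hC).
have tn W : smooth_vfield W -> tangent y (nabla y (X' y) W) by exact: nabla_tangent.
have EF u : tangent p u -> E y (tangent_map F u) by move=> tu; rewrite hE.2; exists u.
have tnadj W : is_section E W ->
    tangent p (nabla p (X p) (fun q => adjoint_map F q (W (F q)))).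
  move=> hW; apply: nabla_tangent; first exact: hX.1.1.
  exact: (section_adjoint sF rF hE hW).1.1.
set a := (X in _ <-> X = 0 /\ _); set b := (X in _ <-> _ /\ X = 0).
have Ea : E y a.
  rewrite /a; do ! apply: (subbundleD sE).
  - exact: (orth_proj_in sE (tn _ homega.1)).
  - exact: (EF _ (tnadj _ hB)).
  - exact: (orth_proj_in sE (tn _ hC.1)).
  - exact: (nabla_perp_preserves sE gE y hV hphi).
  - exact: (nabla_perp_preserves sE gE y hV hB).
  - exact: (EF _ (tnadj _ hphi)).
have XX' q : tangent_map F (X q) = X' (F q) by rewrite XX.
have pb : perp E y b.
  rewrite /b; apply: (perpD sE); last exact: (nabla_perp_in sE gE y hV hC).
  apply: (perpD sE); last exact: (nabla_perp_in sE gE y hV homega).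
  apply: (perpD sE); last exact: (orth_proj_perp sE (tn _ hC.1)).
  apply: (perpD sE); last exact: (nabla_sub_perp sF rF hE p hX hX' hB XX').
  apply: (perpD sE); last exact: (orth_proj_perp sE (tn _ homega.1)).
  exact: (nabla_sub_perp sF rF hE p hX hX' hphi XX').
set c := (X in X = 0 <-> _); have <- : a + b = c by exact: sum_regroup.
split=> [ab0|[-> ->]]; last exact: addr0.
(* If [a + b] is 0, then [a] lies in [E] and, being [- b], also in its complement. *)
have a0 : a = 0.
  apply: (perp_cap Ea); have -> : a = 0 - b by rewrite -ab0 addrK.
  apply: (perpB sE) => //; split; first exact: tangent0.
  by move=> w Ew; apply: metric0l; exact: subbundle_tangent Ew.
by split=> //; move: ab0; rewrite a0 add0r.
Qed.

End Acceleration.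

Theorem theorem4 (R : realType) (m n r : nat)
    (M : riemannian R m) (N : riemannian R n)
    (P : N -> functional N R -> functional N R)
    (F : M -> N)
    (E D1 D2 : N -> set (functional N R))
    (DF : M -> functional M R -> (M -> functional N R) -> functional N R)
    (I : set R) (alpha : R -> M)
    (Dalpha : (R -> functional M R) -> R -> functional M R)
    (Dbeta : (R -> functional N R) -> R -> functional N R)
    (X : R -> vfield M R) (FX V : R -> vfield N R)
    (hP : is_kahler P)
    (hF : smooth_map F)
    (hrank : constant_rank F r)
    (hr : (0 < r < minn m n)%N)
    (hriem : riemannian_map F)
    (hE : range_distribution F E)
    (hsemi : semi_invariant P E D1 D2)
    (hgeod : perp_totally_geodesic E)
    (hDF : is_pullback_connection F DF)
    (hIopen : open I) (hI : is_interval I)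
    (halpha : smooth_curve I alpha)
    (hDalpha : is_covariant_derivative I alpha Dalpha)
    (halpha_geod : is_geodesic I alpha Dalpha)
    (hDbeta : is_covariant_derivative I (F \o alpha) Dbeta)
    (hX : forall t, I t -> is_section (perp (ker_tangent_map F)) (X t))
    (hFX : forall t, I t -> is_section E (FX t))
    (hFXX : forall t, I t -> forall p : M, FX t (F p) = tangent_map F (X t p))
    (hV : forall t, I t -> is_section (perp E) (V t))
    (hdec : forall t, I t -> \forall s \near t,
       velocity (F \o alpha) s = FX t (F (alpha s)) + V t (F (alpha s))) :
  is_geodesic I (F \o alpha) Dbeta <->
  forall t, I t ->
    let p := alpha t in
    let y := F p in
    let x := X t p in
    let fx := FX t y in
    let v := V t y in
    let phiFX := fun q => phi_op P D1 D2 q (FX t q) in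
    let omegaFX := fun q => omega_op P D1 D2 q (FX t q) in
    let BV := fun q => Bpart P E D2 q (V t q) in
    let CV := fun q => Cpart P E D2 q (V t q) in
    let adj_phiFX := fun q : M => adjoint_map F q (phiFX (F q)) in
    let adj_BV := fun q : M => adjoint_map F q (BV (F q)) in
    - shape_op E y omegaFX fx + tangent_map F (nabla p x adj_BV)
      - shape_op E y CV fx + nabla y v phiFX + nabla y v BV
      + tangent_map F (nabla p x adj_phiFX) = 0
    /\
    second_fundamental_form F DF p x adj_phiFX + nabla_perp E y fx omegaFX
      + second_fundamental_form F DF p x adj_BV + nabla_perp E y fx CV
      + nabla_perp E y v omegaFX + nabla_perp E y v CV = 0.
Proof.
have sbeta (f : N -> R) t : smooth_fun f -> I t ->
    smooth_at (t : R^o) (f \o (F \o alpha) : R^o -> R^o).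
  move=> sf It; exact: (smooth_fun_curve halpha It (smooth_fun_pullback hF sf)).
have tvel s : I s -> tangent ((F \o alpha) s) (velocity (F \o alpha) s).
  move=> Is; rewrite (nbhs_singleton (hdec s Is)).
  by apply: tangentD; [exact: (hFX s Is).1.1|exact: (hV s Is).1.1].
(* The fields depend on the time: for each [t] they are frozen, and matching the velocity near that
   [t] is enough by locality of the covariant derivative. *)
have acc t : I t -> Dbeta (velocity (F \o alpha)) t =
    nabla (F (alpha t)) (FX t (F (alpha t)) + V t (F (alpha t)))
      (fun q => FX t q + V t q).
  move=> It; apply: (covariant_derivative_velocity hIopen sbeta hDbeta _ It tvel).
    exact: smooth_vfieldD (hFX t It).1 (hV t It).1.
  exact: hdec.
split=> H t It.
  apply/(acceleration_eq0 hP hF hriem hE hsemi hgeod hDF (alpha t)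
    (hX t It) (hFX t It) (hFXX t It) (hV t It)).
  by rewrite -acc//; exact: H.
rewrite acc//; apply/(acceleration_eq0 hP hF hriem hE hsemi hgeod hDF (alpha t)
    (hX t It) (hFX t It) (hFXX t It) (hV t It)).
exact: H.
Qed.
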